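(* Let $m=2$. If $\mathcal{B}$ has no pair of linearly dependent rows lying in the interiors of opposite quadrants of $\mathbb{Z}^2$, then $\mathrm{rank}(H_{\mathcal{B}}(c))=d_1\cdot d_2$ for all $c\in\mathbb{C}^n$.
   Context: $\mathcal{B}=(b_{ji})\in\mathbb{Z}^{n\times2}$ ($n>2$) of rank 2 with rows $b_j$ summing to zero and columns $b^{(1)},b^{(2)}$; $A=(a_{kj})\in\mathbb{Z}^{(n-2)\times n}$ of rank $n-2$, first row all ones, $A\mathcal{B}=0$. $I=\langle\partial^{b^{(1)}_+}-\partial^{b^{(1)}_-},\partial^{b^{(2)}_+}-\partial^{b^{(2)}_-}\rangle$ (with $u=u_+-u_-$, $u_\pm\ge0$ of disjoint supports), and $H_{\mathcal{B}}(c)=D_nI+D_n\langle\sum_ja_{kj}x_j\partial_j-(Ac)_k:k=1,\dots,n-2\rangle$. $d_i=\sum_{j:b_{ji}>0}b_{ji}$ is the degree of the $i$-th generator of $I$. Rank = dimension of the space of holomorphic solutions near a generic point. *)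

(* Defs.v *)
(* complex numbers C = R[i] for R : realType (real_closed's complex),
   holomorphic germs at a point p represented as convergent power series centred at p. *)
From HB Require Import structures.
From mathcomp Require Import all_boot all_order all_algebra.
From mathcomp Require Import reals.
From mathcomp.real_closed Require Import complex.
From mathcomp Require Import mpoly.
Set Implicit Arguments. Unset Strict Implicit. Unset Printing Implicit Defensive.
Import Order.TTheory GRing.Theory Num.Theory.
Local Open Scope ring_scope.

Section Defs.
Variable (R : realType) (n : nat).
Local Notation C := (R[i]).

Definition mindex := {ffun 'I_n -> nat}.
Definition mdeg (a : mindex) : nat := (\sum_(j < n) a j)%N.
Definition maddu (a : mindex) (j : 'I_n) : mindex := [ffun i => (a i + (i == j))%N].
Definition msubu (a : mindex) (j : 'I_n) : mindex := [ffun i => (a i - (i == j))%N].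

(* A power series  sum_a f a (x - p)^a  centred at p, given by its coefficients. *)
Definition pseries := mindex -> C.

(* Convergent power series = holomorphic germs at p (O_p ~ C{x - p}). *)
Definition convergent (f : pseries) : Prop :=
  exists r M : C, 0 < r /\ forall a : mindex, `|f a| * r ^+ mdeg a <= M.

(* Action of the Weyl algebra generators on germs at p, in coordinates x - p. *)
Definition dpart (j : 'I_n) (f : pseries) : pseries :=
  fun a => (a j).+1%:R * f (maddu a j).
Definition mulx (p : 'I_n -> C) (j : 'I_n) (f : pseries) : pseries :=
  fun a => p j * f a + (if (0 < a j)%N then f (msubu a j) else 0).
Definition dpow (u : mindex) (f : pseries) : pseries :=
  foldr (fun j g => iter (u j) (dpart j) g) f (enum 'I_n).

Definition sub_ps (f g : pseries) : pseries := fun a => f a - g a.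
Definition scale_ps (c : C) (f : pseries) : pseries := fun a => c * f a.
Definition sum_ps (fs : seq pseries) : pseries := fun a => \sum_(g <- fs) g a.

Definition colpos (B : 'M[int]_(n, 2)) (i : 'I_2) : mindex :=
  [ffun j => if (0 <= B j i)%R then absz (B j i) else 0%N].
Definition colneg (B : 'M[int]_(n, 2)) (i : 'I_2) : mindex :=
  [ffun j => if (B j i < 0)%R then absz (B j i) else 0%N].

Definition binom_op (B : 'M[int]_(n, 2)) (i : 'I_2) (f : pseries) : pseries :=
  sub_ps (dpow (colpos B i) f) (dpow (colneg B i) f).

Definition euler_op (A : 'M[int]_(n - 2, n)) (c : 'I_n -> C) (p : 'I_n -> C)
    (k : 'I_(n - 2)) (f : pseries) : pseries :=
  sub_ps (sum_ps [seq scale_ps ((A k j)%:~R) (mulx p j (dpart j f)) | j <- enum 'I_n])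
         (scale_ps (\sum_(j < n) (A k j)%:~R * c j) f).

Definition ps_zero (f : pseries) : Prop := forall a, f a = 0.

(* holomorphic germ at p annihilated by the generators of H_B(c)
   (hence by the whole left ideal H_B(c)) *)
Definition is_solution (A : 'M[int]_(n - 2, n)) (B : 'M[int]_(n, 2))
    (c p : 'I_n -> C) (f : pseries) : Prop :=
  [/\ convergent f,
      forall i : 'I_2, ps_zero (binom_op B i f)
    & forall k : 'I_(n - 2), ps_zero (euler_op A c p k f)].

Definition sol_dim (A : 'M[int]_(n - 2, n)) (B : 'M[int]_(n, 2))
    (c p : 'I_n -> C) (r : nat) : Prop :=
  exists s : 'I_r -> pseries,
    [/\ forall l, is_solution A B c p (s l),
        (forall lam : 'I_r -> C,
            ps_zero (sum_ps [seq scale_ps (lam l) (s l) | l <- enum 'I_r]) ->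
            forall l, lam l = 0)
      & forall f, is_solution A B c p f ->
          exists lam : 'I_r -> C, forall a,
            f a = sum_ps [seq scale_ps (lam l) (s l) | l <- enum 'I_r] a].

(* rank(H_B(c)) = r : the solution space has dimension r at every point outside
   a proper algebraic hypersurface (i.e. near a generic point). *)
Definition hrank (A : 'M[int]_(n - 2, n)) (B : 'M[int]_(n, 2))
    (c : 'I_n -> C) (r : nat) : Prop :=
  exists g : {mpoly C[n]}, g != 0 /\
    forall p : 'I_n -> C, g.@[p] != 0 -> sol_dim A B c p r.

Definition degB (B : 'M[int]_(n, 2)) (i : 'I_2) : nat :=
  (\sum_(j < n | (0 < B j i)%R) absz (B j i))%N.

End Defs.

(* Main.v *)
(* Write [F a = a! f_a] for the Taylor coefficients of [f] at [p].  The Euler operators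
   force [F a = p^-a gam (prod_j [c_j + ell_j]_(a_j))], where [x]_m is the falling
   factorial, [ell_j] is the linear form on C^2 given by the j-th row of B, and [gam] is a
   linear form on [K = C[s,t]]; conversely every [gam] arises once.  The two binomial
   operators then say that [gam] vanishes on the images of two operators [H1], [H2] on
   [K], of degrees [d1], [d2], whose symbols are the binary forms
     [h_i = p^(-b_+) prod ell_j^(b_ji)_+ - p^(-b_-) prod ell_j^(b_ji)_-].
   The hypothesis on opposite quadrants makes [h1], [h2] coprime for generic [p].  The
   commutation of the binomial operators lifts the Koszul syzygy of [(h1, h2)] to an
   identity [H1 H2' = H2 H1'] with operators having the same symbols, so that
   [K / (H1 K + H2 K)] has the same dimension [d1 d2] as [K / (h1, h2)], whatever [c] is.
   Convergence is automatic: the symbols generate all forms of large degree, so every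
   Taylor coefficient of order [m] is [O(m)] times those of order [m - 1]. *)
From HB Require Import structures.
From mathcomp Require Import all_boot all_order all_algebra.
From mathcomp Require Import reals.
From mathcomp.real_closed Require Import complex.
From mathcomp Require Import mpoly.
From mathcomp Require Import zify ring.
From Stdlib Require Import FunctionalExtensionality.
Require Import Defs.
Set Implicit Arguments. Unset Strict Implicit. Unset Printing Implicit Defensive.
Import Order.TTheory GRing.Theory Num.Theory.
Local Open Scope ring_scope.

(** * Finite linear algebra *)

(** The parameter [c] changes only the lower-degree terms of [H1] and [H2], so everything decided by
    symbols is uniform in [c]. The obstacle is that both operators involve a translation of (s, t):
    they are not multiplications and need not commute, and the Koszul relation holds only after the
    parameters of the inner operators are shifted. The dimension comes out by counting polynomials
    of degree at most [d1 + d2 - 2]. Coprimality reduces to the four products that make up [h1] and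
    [h2]. As [B] has rank 2, the ratios of p^(b_+) to p^(b_-) for the two columns take infinitely
    many values independently, and well-chosen members of the two pencils share a zero only where
    all four products vanish. Such a zero is a vector orthogonal to rows with first entries of both
    signs and to rows with second entries of both signs. Neither of its coordinates can be 0, so a
    row with positive and a row with negative first entry are proportional and lie in opposite open
    quadrants, which the hypothesis forbids. *)

Section LinearAlgebra.
Variables (F : fieldType) (I J : finType) (M : I -> J -> F).
Hypothesis M_inj : forall v : I -> F,
  (forall j, \sum_i v i * M i j = 0) -> forall i, v i = 0.

Let mxM : 'M_(#|I|, #|J|) := \matrix_(x, y) M (enum_val x) (enum_val y).

Lemma family_row_free : row_free mxM.
Proof.
apply: inj_row_free => w w0; apply/rowP => x; rewrite mxE -[x]enum_valK.
apply: (M_inj (v := fun i => w 0 (enum_rank i))) => j.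
have /rowP/(_ (enum_rank j)) := w0; rewrite mxE [RHS]mxE => w0j; rewrite -[RHS]w0j.
rewrite (reindex (@enum_val I predT)) /=; last exact/onW_bij/enum_val_bij.
by apply: eq_bigr => y _; rewrite !mxE enum_valK enum_rankK.
Qed.

Lemma family_left_inverse : exists M' : J -> I -> F,
  forall v i, v i = \sum_j (\sum_i' v i' * M i' j) * M' j i.
Proof.
have /row_freeP[M' MM'] := family_row_free.
exists (fun j i => M' (enum_rank j) (enum_rank i)) => v i.
pose w : 'rV[F]_#|I| := \row_x v (enum_val x).
have -> : v i = w 0 (enum_rank i) by rewrite mxE enum_rankK.
rewrite -[w]mulmx1 -MM' mulmxA mxE.
rewrite [RHS](reindex (@enum_val J predT)) /=; last exact/onW_bij/enum_val_bij.
apply: eq_bigr => y _; rewrite enum_valK; congr (_ * _); rewrite mxE.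
rewrite [RHS](reindex (@enum_val I predT)) /=; last exact/onW_bij/enum_val_bij.
by apply: eq_bigr => x _; rewrite !mxE.
Qed.

(** Rank-nullity: the rows of [M] are independent, so its right kernel has dimension
    [#|J| - #|I|]. *)
Lemma family_null_basis r : (r + #|I|)%N = #|J| ->
  exists G : 'I_r -> J -> F,
  [/\ forall l i, \sum_j M i j * G l j = 0,
      forall lam : 'I_r -> F,
        (forall j, \sum_l lam l * G l j = 0) -> forall l, lam l = 0
    & forall g : J -> F, (forall i, \sum_j M i j * g j = 0) ->
        exists lam : 'I_r -> F, forall j, g j = \sum_l lam l * G l j].
Proof.
move=> rE; pose N := kermx mxM^T.
have rkN : \rank N = r.
  by rewrite mxrank_ker mxrank_tr (eqP family_row_free) -rE addnK.
have [X [Xfree XN]] : exists X : 'M_(r, #|J|), row_free X /\ (X :=: N)%MS.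
  by rewrite -rkN; exists (row_base N); rewrite row_base_free; split=> //; exact: eq_row_base.
exists (fun l j => X l (enum_rank j)); split.
- move=> l i; have /sub_kermxP/rowP/(_ (enum_rank i)) : (row l X <= N)%MS.
    by rewrite -XN row_sub.
  rewrite mxE [RHS]mxE => N0; rewrite -[RHS]N0.
  rewrite (reindex (@enum_val J predT)) /=; last exact/onW_bij/enum_val_bij.
  by apply: eq_bigr => y _; rewrite !mxE enum_valK enum_rankK mulrC.
- move=> lam lam0 l.
  have : (\row_l' lam l') *m X = 0.
    apply/rowP => y; rewrite mxE [RHS]mxE -[RHS](lam0 (enum_val y)).
    by apply: eq_bigr => x _; rewrite !mxE enum_valK.
  rewrite -[RHS](mul0mx _ X) => /(row_free_inj Xfree)/rowP/(_ l).
  by rewrite !mxE.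
- move=> g g0; pose w : 'rV[F]_#|J| := \row_y g (enum_val y).
  have : (w <= X)%MS.
    rewrite XN; apply/sub_kermxP/rowP => x; rewrite mxE [RHS]mxE -[RHS](g0 (enum_val x)).
    rewrite [RHS](reindex (@enum_val J predT)) /=; last exact/onW_bij/enum_val_bij.
    by apply: eq_bigr => y _; rewrite !mxE mulrC.
  case/submxP => D wD; exists (fun l => D 0 l) => j.
  have -> : g j = w 0 (enum_rank j) by rewrite mxE enum_rankK.
  by rewrite wD mxE.
Qed.
End LinearAlgebra.

(** * Coprime polynomials and homogenization *)

Section CoprimePolynomials.
Variables (F : fieldType) (h1 h2 : {poly F}) (a b : nat).
Hypotheses (h_coprime : coprimep h1 h2) (size_h1 : size h1 = a.+2) (size_h2 : size h2 = b.+2).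

Let h1_neq0 : h1 != 0. Proof. by rewrite -size_poly_gt0 size_h1. Qed.
Let h2_neq0 : h2 != 0. Proof. by rewrite -size_poly_gt0 size_h2. Qed.

Lemma size_cofactor (h r : {poly F}) d k :
  size h = d.+2 -> (size (h * r)%R <= d.+1 + k)%N -> (size r <= k)%N.
Proof.
move=> size_h; have [->|r0] := eqVneq r 0; first by rewrite size_poly0.
have h0 : h != 0 by rewrite -size_poly_gt0 size_h.
by rewrite size_mul // size_h !addSn /= ltnS leq_add2l.
Qed.

(** Dehomogenized version of the fact that coprime binary forms of degrees [a + 1] and [b + 1]
    generate all forms of degree [m > a + b]; the sizes allowed for [r1] and [r2] are those of forms
    of degrees [m - a - 1] and [m - b - 1]. Reducing the Bezout cofactor of [h2] modulo [h1] bounds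
    [r2], and the bound on [r1] follows by comparing degrees. *)
Lemma coprimep_decompose (r : {poly F}) m : (a + b < m)%N -> (size r <= m.+1)%N ->
  exists r1 r2, [/\ r = h1 * r1 + h2 * r2, (size r1 <= m - a)%N & (size r2 <= m - b)%N].
Proof.
move=> abm size_r; have /Bezout_eq1_coprimepP[[u v] /= uv1] := h_coprime.
pose e : {poly F} := (v * r) %/ h1; pose r2 : {poly F} := (v * r) %% h1.
have size_r2 : (size r2 <= a.+1)%N by rewrite -ltnS -size_h1 ltn_modp.
have rE : r = h1 * (u * r + e * h2) + h2 * r2.
  have vr : v * r = e * h1 + r2 := divp_eq _ _.
  by rewrite -[LHS]mul1r -uv1 mulrDl -[v * h2 * r]mulrAC vr; ring.
exists (u * r + e * h2), r2; split=> //; last by apply: leq_trans size_r2 _; lia.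
apply: (size_cofactor size_h1); rewrite -[h1 * _](addrK (h2 * r2)) -rE.
apply: leq_trans (size_polyD _ _) _; rewrite size_polyN geq_max; apply/andP; split; first by apply: leq_trans size_r _; lia.
have [->|r20] := eqVneq r2 0; first by rewrite mulr0 size_poly0.
rewrite size_mul // size_h2 !addSn /=.
by apply: (leq_trans (_ : _ <= (b + a.+1).+1)%N); [rewrite ltnS leq_add2l|lia].
Qed.

Lemma coprimep_syzygy (u v : {poly F}) : h1 * u + h2 * v = 0 ->
  exists r, u = h2 * r /\ v = - (h1 * r).
Proof.
move=> uv0; have h2u : h2 %| u.
  by rewrite -(Gauss_dvdpr _ (_ : coprimep h2 h1)) 1?coprimep_sym //
     (canRL (addrK _) uv0) sub0r dvdpNr dvdp_mulr.
have uE : u = h2 * (u %/ h2) by rewrite mulrC divpK.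
exists (u %/ h2); split=> //; apply: (mulfI h2_neq0).
have -> : h2 * v = - (h1 * u) by apply/eqP; rewrite -subr_eq0 opprK addrC uv0.
by rewrite {1}uE; ring.
Qed.
End CoprimePolynomials.

(* A bivariate polynomial in [F[t][s]] is homogenized by s = x * tau, t = tau:
   the coefficient of [tau ^ m] in [hmg q] is the dehomogenized component of
   degree [m] of [q]. *)
Section Homogenization.
Variable F : fieldType.
Local Notation K := {poly {poly F}}.
Local Notation cst c := (c%:P%:P : K).

Definition hmg : K -> K := horner_eval ('X%:P * 'X) \o map_poly (map_poly polyC).
HB.instance Definition _ := GRing.RMorphism.on hmg.

Lemma hmg0 : hmg 0 = 0. Proof. exact: rmorph0. Qed.
Lemma hmgD p q : hmg (p + q) = hmg p + hmg q. Proof. exact: rmorphD. Qed.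
Lemma hmgN q : hmg (- q) = - hmg q. Proof. exact: rmorphN. Qed.
Lemma hmgM p q : hmg (p * q) = hmg p * hmg q. Proof. exact: rmorphM. Qed.
Lemma hmg_sum (I : Type) (s : seq I) (P : pred I) (q : I -> K) :
  hmg (\sum_(i <- s | P i) q i) = \sum_(i <- s | P i) hmg (q i).
Proof. exact: rmorph_sum. Qed.

Lemma hmg_poly (r : {poly F}) : hmg r%:P = map_poly polyC r.
Proof. by rewrite /hmg /= /horner_eval map_polyC hornerC. Qed.
Lemma hmg_cst c : hmg (cst c) = cst c.
Proof. by rewrite hmg_poly map_polyC. Qed.
Lemma hmg_s : hmg 'X = 'X%:P * 'X.
Proof. by rewrite /hmg /= /horner_eval map_polyX hornerX. Qed.

(** The monomial s^i t^(m-i) becomes x^i tau^m, so distinct monomials stay distinct and no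
    information is lost. *)
Lemma coef_hmg q m i : (hmg q)`_m`_i = if (i <= m)%N then q`_i`_(m - i) else 0.
Proof.
have mapC_inj : injective (map_poly (@polyC F)).
  by apply: map_inj_poly; [exact: polyC_inj|exact: rmorph0].
rewrite /hmg /= /horner_eval horner_coef size_map_inj_poly ?rmorph0 //.
rewrite coef_sum coef_sum.
under eq_bigr => k _.
  rewrite exprMn -rmorphXn /= mulrA coefMXn coef_map /=.
  rewrite (_ : _`_i = if (k <= m)%N then (if (i == k)%N then q`_k`_(m - k) else 0) else 0).
    over.
  case: (leqP k m) => [km|_]; last exact: coef0.
  by rewrite coefMC coef_map /= mulrC coefMC coefXn; case: eqP; rewrite ?mul1r ?mul0r.
case: (ltnP i (size q)) => iq; last first.
  rewrite (nth_default 0 iq) coef0 if_same big1 // => k _.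
  by case: eqP => [ik|]; rewrite ?if_same //; move: iq; rewrite ik leqNgt ltn_ord.
rewrite (bigD1 (Ordinal iq)) //= eqxx big1 ?addr0 // => k ki.
by rewrite (_ : (i == k) = false) ?if_same //; apply/eqP => ik; case/eqP: ki; apply/val_inj.
Qed.

Lemma hmg_inj : injective hmg.
Proof.
move=> p q pq; apply/polyP => i; apply/polyP => k.
have := congr1 (fun r : K => r`_(i + k)`_i) pq.
by rewrite /= !coef_hmg leq_addr addnC addnK.
Qed.

Lemma size_coef_hmg q m : (size ((hmg q)`_m)%R <= m.+1)%N.
Proof. by apply/leq_sizeP => i im; rewrite coef_hmg leqNgt im. Qed.

Definition mon m i : K := ('X^(m - i))%:P * 'X^i.
(** The form of degree [m] that dehomogenizes to [r], when [r] has degree at most [m]. *)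
Definition lift m (r : {poly F}) : K := \sum_(i < m.+1) cst r`_i * mon m i.

Lemma hmg_mon m i : (i <= m)%N -> hmg (mon m i) = ('X^i)%:P * 'X^m.
Proof.
move=> im; rewrite hmgM hmg_poly map_polyXn rmorphXn /= hmg_s exprMn mulrCA.
by rewrite -exprD subnK // rmorphXn.
Qed.

Lemma hmg_lift m (r : {poly F}) : (size r <= m.+1)%N -> hmg (lift m r) = r%:P * 'X^m.
Proof.
move=> size_r; rewrite /lift hmg_sum.
under eq_bigr => i _ do rewrite hmgM hmg_cst hmg_mon -1?ltnS // mulrA -rmorphM /=.
rewrite -mulr_suml -rmorph_sum /=; congr (_%:P * _).
rewrite [RHS](_ : r = \poly_(i < m.+1) r`_i).
  by rewrite poly_def; apply: eq_bigr => i _; rewrite mul_polyC.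
apply/polyP => i; rewrite coef_poly; case: ltnP => // im.
by rewrite nth_default // (leq_trans size_r).
Qed.

Lemma hmg_expand e q : (size (hmg q) <= e)%N -> q = \sum_(m < e) lift m (hmg q)`_m.
Proof.
move=> size_q; apply: hmg_inj; rewrite hmg_sum.
under eq_bigr => m _ do rewrite hmg_lift ?size_coef_hmg //.
rewrite [LHS](_ : _ = \poly_(m < e) (hmg q)`_m).
  by rewrite poly_def; apply: eq_bigr => i _; rewrite mul_polyC.
apply/polyP => i; rewrite coef_poly; case: ltnP => // im.
by rewrite nth_default // (leq_trans size_q).
Qed.

(** Index set of the monomials s^i t^(m-i) of degree [m < e]; [cof] gives the coordinates in
    them. *)
Definition mindices e := {m : 'I_e & 'I_m.+1}.
Definition monJ e (j : mindices e) : K := mon (tag j) (tagged j).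
Definition cof e (q : K) (j : mindices e) : F := (hmg q)`_(tag j)`_(tagged j).

Lemma hmg_coords e q : (size (hmg q) <= e)%N ->
  q = \sum_(j : mindices e) cst (cof q j) * monJ j.
Proof.
move/hmg_expand => {1}->; rewrite /lift sig_big_dep /=.
by apply: eq_bigr.
Qed.

Lemma size_CXn (r : {poly F}) m : (size (r%:P * 'X^m)%R <= m.+1)%N.
Proof. by apply/leq_sizeP => j mj; rewrite coefCM coefXn gtn_eqF ?mulr0. Qed.

Lemma size_hmg_monJ e (j : mindices e) : (size (hmg (monJ j)) <= e)%N.
Proof.
rewrite hmg_mon -1?ltnS //.
by apply: leq_trans (size_CXn _ _) _; exact: ltn_ord.
Qed.

Lemma card_mindices e : #|{: mindices e}| = 'C(e.+1, 2).
Proof.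
rewrite card_tagged sumnE big_map big_enum /=; under eq_bigr => i _ do rewrite card_ord.
by elim: e => [|e IH]; rewrite ?big_ord0 // big_ord_recr /= IH [RHS]binS bin1 addnC.
Qed.

(** A weak leading symbol: [r] may be 0, which keeps the relation additive. [symb m q 0] then says
    that the degree of [q] is below [m], and this drives the descents on the degree. *)
Definition symb m (q : K) (r : {poly F}) := (size (hmg q) <= m.+1)%N /\ (hmg q)`_m = r.

Lemma size_hmgN q : size (hmg (- q)) = size (hmg q).
Proof. by rewrite hmgN size_polyN. Qed.

Lemma size_hmg_gt0 q : (0 < size (hmg q))%N = (q != 0).
Proof. by rewrite size_poly_gt0 -{1}hmg0 (inj_eq hmg_inj). Qed.

Lemma symb_top q : q != 0 ->
  symb (size (hmg q)).-1 q (lead_coef (hmg q)) /\ lead_coef (hmg q) != 0.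
Proof.
move=> q0; rewrite lead_coef_eq0 -hmg0 (inj_eq hmg_inj) q0.
by rewrite /symb lead_coefE; split=> //; split=> //; exact: leqSpred.
Qed.

Lemma symb_size m q : (size (hmg q) <= m.+1)%N -> symb m q (hmg q)`_m.
Proof. by []. Qed.

Lemma symb_size_eq m q r : symb m q r -> r != 0 -> size (hmg q) = m.+1.
Proof.
move=> [size_q qm] r0; apply/eqP; rewrite eqn_leq size_q ltnNge.
by apply/negP => /leq_sizeP/(_ m (leqnn m)) q0; rewrite -qm q0 eqxx in r0.
Qed.

Lemma symb0_size m q : symb m q 0 -> (size (hmg q) <= m)%N.
Proof.
move=> [size_q qm]; apply/leq_sizeP => j; rewrite leq_eqVlt => /orP[/eqP<-//|].
by move=> mj; rewrite nth_default // (leq_trans size_q).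
Qed.

Lemma symb_low m q : (size (hmg q) <= m)%N -> symb m q 0.
Proof. by move=> size_q; split; [exact: leqW|rewrite nth_default]. Qed.

Lemma symbD m p q r r' : symb m p r -> symb m q r' -> symb m (p + q) (r + r').
Proof.
move=> [sp pm] [sq qm]; split; rewrite hmgD ?coefD ?pm ?qm //.
by rewrite (leq_trans (size_polyD _ _)) // geq_max sp.
Qed.

Lemma symbN m q r : symb m q r -> symb m (- q) (- r).
Proof. by move=> [sq qm]; split; rewrite hmgN ?size_polyN // coefN qm. Qed.

Lemma symbB m p q r r' : symb m p r -> symb m q r' -> symb m (p - q) (r - r').
Proof. by move=> sp sq; apply: symbD => //; apply: symbN. Qed.

Lemma symbM m k p q r r' : symb m p r -> symb k q r' -> symb (m + k) (p * q) (r * r').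
Proof.
move=> [sp pm] [sq qk]; split; rewrite hmgM.
  apply: leq_trans (size_polyMleq _ _) _; rewrite -subn1 leq_subLR.
  by apply: leq_trans (leq_add sp sq) _; rewrite addSn addnS.
rewrite coefM (bigD1 (inord m : 'I_(m + k).+1)) //= inordK ?ltnS ?leq_addr //.
rewrite addKn pm qk big1 ?addr0 // => i im.
have {im} im : (i : nat) != m.
  by apply: contraNneq im => im; apply/eqP/val_inj; rewrite /= inordK ?ltnS ?leq_addr.
case: (ltnP m i) => mi; first by rewrite nth_default ?mul0r //; apply: leq_trans sp _.
by rewrite [X in _ * X]nth_default ?mulr0 //; apply: leq_trans sq _; lia.
Qed.

Lemma symb_cst c : symb 0 (cst c) c%:P.
Proof. by split; rewrite hmg_cst ?coefC // size_polyC_leq1. Qed.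

Lemma symb_sum (I : Type) (s : seq I) (P : pred I) m (q : I -> K) r :
  (forall i, P i -> symb m (q i) (r i)) ->
  symb m (\sum_(i <- s | P i) q i) (\sum_(i <- s | P i) r i).
Proof.
move=> qr; elim/big_rec2: _ => [|i r' q' Pi s']; last by apply: symbD; auto.
by apply: symb_low; rewrite hmg0 size_poly0.
Qed.

Lemma symbZ m c q r : symb m q r -> symb m (cst c * q) (c%:P * r).
Proof. exact: symbM (symb_cst c). Qed.

Lemma symb_prod (I : Type) (s : seq I) (m : I -> nat) (q : I -> K) r :
  (forall i, symb (m i) (q i) (r i)) ->
  symb (\sum_(i <- s) m i) (\prod_(i <- s) q i) (\prod_(i <- s) r i).
Proof.
move=> qr; elim: s => [|i s IH]; last by rewrite !big_cons; apply: symbM.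
by rewrite !big_nil; exact: (symb_cst 1).
Qed.

Lemma symbX m q r k : symb m q r -> symb (k * m) (q ^+ k) (r ^+ k).
Proof.
move=> qr; elim: k => [|k IH]; first exact: (symb_cst 1).
by rewrite !exprS mulSn; apply: symbM.
Qed.

Lemma symb_mon m i : (i <= m)%N -> symb m (mon m i) 'X^i.
Proof.
move=> im; split; rewrite hmg_mon //; first exact: size_CXn.
by rewrite coefCM coefXn eqxx mulr1.
Qed.

Lemma symb_lift m (r : {poly F}) : (size r <= m.+1)%N -> symb m (lift m r) r.
Proof.
move=> size_r; split; rewrite hmg_lift //; first exact: size_CXn.
by rewrite coefCM coefXn eqxx mulr1.
Qed.
End Homogenization.

(** * The quotient by a deformed Koszul pair *)

Section Linear.
Variable F : fieldType.
Local Notation K := {poly {poly F}}.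
Local Notation cst c := (c%:P%:P : K).

(** Linearity over the scalars [F] only: operators that translate t are not linear over the
    coefficient ring of [K]. *)
Definition op_linear (H : K -> K) := forall c p q, H (cst c * p + q) = cst c * H p + H q.
Definition form_linear (g : K -> F) := forall c p q, g (cst c * p + q) = c * g p + g q.

Lemma op_linear0 H : op_linear H -> H 0 = 0.
Proof.
by move=> /(_ (-1) 0 0); rewrite mulr0 addr0 !polyCN mulN1r addNr.
Qed.
Lemma op_linearD H p q : op_linear H -> H (p + q) = H p + H q.
Proof. by move=> /(_ 1 p q); rewrite !mul1r. Qed.
Lemma op_linearB H p q : op_linear H -> H (p - q) = H p - H q.
Proof. by move=> /(_ (-1) q p); rewrite !polyCN !mulN1r addrC => ->; rewrite addrC. Qed.
Lemma op_linearZ H c p : op_linear H -> H (cst c * p) = cst c * H p.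
Proof. by move=> Hl; rewrite -[_ * p]addr0 Hl op_linear0 // addr0. Qed.
Lemma op_linear_sum H (I : Type) (s : seq I) (c : I -> F) (q : I -> K) : op_linear H ->
  H (\sum_(i <- s) cst (c i) * q i) = \sum_(i <- s) cst (c i) * H (q i).
Proof.
move=> Hl; elim: s => [|i s IH]; first by rewrite !big_nil op_linear0.
by rewrite !big_cons Hl IH.
Qed.

Lemma form_linear0 g : form_linear g -> g 0 = 0.
Proof. by move=> /(_ (-1) 0 0); rewrite mulr0 addr0 mulN1r addNr. Qed.
Lemma form_linearD g p q : form_linear g -> g (p + q) = g p + g q.
Proof. by move=> /(_ 1 p q); rewrite !mul1r. Qed.
Lemma form_linearB g p q : form_linear g -> g (p - q) = g p - g q.
Proof. by move=> /(_ (-1) q p); rewrite !polyCN !mulN1r addrC => ->; rewrite addrC. Qed.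
Lemma form_linearZ g c p : form_linear g -> g (cst c * p) = c * g p.
Proof. by move=> gl; rewrite -[_ * p]addr0 gl form_linear0 // addr0. Qed.
Lemma form_linear_sum g (I : Type) (s : seq I) (c : I -> F) (q : I -> K) : form_linear g ->
  g (\sum_(i <- s) cst (c i) * q i) = \sum_(i <- s) c i * g (q i).
Proof.
move=> gl; elim: s => [|i s IH]; first by rewrite !big_nil form_linear0.
by rewrite !big_cons gl IH.
Qed.
End Linear.

(** Hilbert function of a complete intersection: polynomials of degree at most [a + b], less the
    cofactors of degree below [b] for [H1] and below [a] for [H2]. *)
Lemma codim_count a b :
  (a.+1 * b.+1 + (#|{: mindices b}| + #|{: mindices a}|) = #|{: mindices (a + b).+1}|)%N.
Proof.
have bin2_double e : ('C(e.+1, 2)).*2 = (e * e.+1)%N.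
  by elim: e => [|e IH] //; rewrite binS bin1 doubleD IH; nia.
rewrite !card_mindices; have := bin2_double (a + b).+1.
by have := bin2_double a; have := bin2_double b; nia.
Qed.

Section Koszul.
Variables (F : fieldType) (h1 h2 : {poly F}) (a b : nat).
Hypotheses (h_coprime : coprimep h1 h2) (size_h1 : size h1 = a.+2) (size_h2 : size h2 = b.+2).
Local Notation K := {poly {poly F}}.
Local Notation cst c := (c%:P%:P : K).
Variables (H1 H2 H1' H2' : K -> K).
Hypotheses (H1_lin : op_linear H1) (H2_lin : op_linear H2)
  (H1'_lin : op_linear H1') (H2'_lin : op_linear H2').
Hypotheses (H1_symb : forall m q r, symb m q r -> symb (m + a.+1) (H1 q) (h1 * r))
  (H2_symb : forall m q r, symb m q r -> symb (m + b.+1) (H2 q) (h2 * r))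
  (H1'_symb : forall m q r, symb m q r -> symb (m + a.+1) (H1' q) (h1 * r))
  (H2'_symb : forall m q r, symb m q r -> symb (m + b.+1) (H2' q) (h2 * r)).
Hypothesis H_comm : forall q, H1 (H2' q) = H2 (H1' q).

(** Descent on the degree: a top component of degree above [a + b] is [h1 * r1 + h2 * r2], and
    subtracting the images of the lifted cofactors removes it. *)
Lemma koszul_reduce q : exists w q1 q2,
  q = w + H1 q1 + H2 q2 /\ (size (hmg w) <= (a + b).+1)%N.
Proof.
have [m] : exists m, (size (hmg q) <= m)%N by exists (size (hmg q)).
elim: m q => [|m IH] q size_q.
  by exists q, 0, 0; rewrite (op_linear0 H1_lin) (op_linear0 H2_lin) !addr0; split=> //; apply: leq_trans size_q _.
have [mab|abm] := leqP m (a + b)%N.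
  by exists q, 0, 0; rewrite (op_linear0 H1_lin) (op_linear0 H2_lin) !addr0; split=> //; apply: leq_trans size_q _.
have [r1 [r2 [rE size_r1 size_r2]]] :=
  coprimep_decompose h_coprime size_h1 size_h2 abm (size_coef_hmg q m).
have s1 : symb m (H1 (lift (m - a.+1) r1)) (h1 * r1).
  have -> : m = ((m - a.+1) + a.+1)%N by lia.
  by rewrite addnK; apply/H1_symb/symb_lift/(leq_trans size_r1); lia.
have s2 : symb m (H2 (lift (m - b.+1) r2)) (h2 * r2).
  have -> : m = ((m - b.+1) + b.+1)%N by lia.
  by rewrite addnK; apply/H2_symb/symb_lift/(leq_trans size_r2); lia.
have := symbB (symbB (symb_size size_q) s1) s2.
rewrite (_ : (hmg q)`_m - h1 * r1 - h2 * r2 = 0); last by rewrite rE; ring.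
move=> /symb0_size /IH[w [q1 [q2 [wE size_w]]]].
exists w, (q1 + lift (m - a.+1) r1), (q2 + lift (m - b.+1) r2); split=> //.
rewrite (op_linearD _ _ H1_lin) (op_linearD _ _ H2_lin).
by rewrite [LHS](_ : q = (q - H1 (lift (m - a.+1) r1) - H2 (lift (m - b.+1) r2)) +
  H1 (lift (m - a.+1) r1) + H2 (lift (m - b.+1) r2)); [rewrite wE; ring|ring].
Qed.

(** Strictness for the degree filtration. If [u] and [v] exceed the expected degrees, their top
    symbols cancel and form a multiple [r] of the Koszul syzygy. With [rho] lifting [r], the pair
    [u - H2' rho], [v + H1' rho] has smaller degrees, and [H_comm] leaves the sum unchanged. *)
Lemma koszul_strict u v : (size (hmg (H1 u + H2 v)) <= (a + b).+1)%N ->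
  exists u' v', [/\ (size (hmg u') <= b)%N, (size (hmg v') <= a)%N &
    H1 u' + H2 v' = H1 u + H2 v].
Proof.
move=> size_w.
have [k] : exists k, (size (hmg u) <= b + k)%N /\ (size (hmg v) <= a + k)%N.
  by exists (size (hmg u) + size (hmg v))%N; split; lia.
elim: k u v size_w => [|k IH] u v size_w [size_u size_v].
  by rewrite !addn0 in size_u size_v; exists u, v.
rewrite !addnS in size_u size_v.
have size_w' : (size (hmg (H1 u + H2 v)) <= b + k + a.+1)%N.
  by apply: leq_trans size_w _; lia.
have := symbD (H1_symb (symb_size size_u)) _.
rewrite (_ : b + k + a.+1 = a + k + b.+1)%N; last by lia.
move=> /(_ _ _ (H2_symb (symb_size size_v))) [_].
rewrite nth_default; last by apply: leq_trans size_w _; lia.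
move/esym/(coprimep_syzygy h_coprime size_h2) => [r [uE vE]].
have size_r : (size r <= k)%N.
  apply: (size_cofactor size_h2); rewrite -uE.
  by apply: leq_trans (size_coef_hmg _ _) _; lia.
have [rho [rho1 rho2]] : exists rho, symb (b + k) (H2' rho) (h2 * r) /\
    symb (a + k) (H1' rho) (h1 * r).
  (* With excess 0 the factor [r] has size 0 and [rho = 0] serves; otherwise [rho] is a form of
     degree one less than the excess. *)
  case: k size_r {IH size_u size_v uE vE size_w'} => [|k] size_r.
    exists 0; have -> : r = 0 by apply/eqP; rewrite -size_poly_leq0.
    by rewrite (op_linear0 H1'_lin) (op_linear0 H2'_lin) !mulr0; split; apply: symb_low; rewrite hmg0 size_poly0.
  by exists (lift k r); rewrite !addnS -!addSn [(b.+1 + k)%N]addnC [(a.+1 + k)%N]addnC; split;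
    [apply: H2'_symb|apply: H1'_symb]; apply: symb_lift.
have := IH (u - H2' rho) (v + H1' rho).
rewrite (op_linearB _ _ H1_lin) (op_linearD _ _ H2_lin) H_comm addrACA addNr addr0; apply=> //.
split; apply: symb0_size.
  by rewrite -[X in symb _ _ X](subrr (h2 * r)) -{1}uE; apply: symbB.
by rewrite -[X in symb _ _ X](addNr (h1 * r)) -vE; apply: symbD.
Qed.

(** A cancellation would make the top symbol of [u] a multiple of [h2], whose degree [b + 1] exceeds
    the degree of [u]. *)
Lemma koszul_inj u v : (size (hmg u) <= b)%N -> (size (hmg v) <= a)%N ->
  H1 u + H2 v = 0 -> u = 0 /\ v = 0.
Proof.
have h1_neq0 : h1 != 0 by rewrite -size_poly_gt0 size_h1.
have h2_neq0 : h2 != 0 by rewrite -size_poly_gt0 size_h2.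
have op_neq0 (H : K -> K) h d q : (forall m q r, symb m q r -> symb (m + d.+1) (H q) (h * r)) ->
    h != 0 -> q != 0 ->
    size (hmg (H q)) = (size (hmg q) + d.+1)%N /\ H q != 0.
  move=> H_symb h0 q0; have [/H_symb sq r0] := symb_top q0.
  have size_q : (0 < size (hmg q))%N by rewrite size_hmg_gt0.
  have sE := symb_size_eq sq (mulf_neq0 h0 r0).
  split; first by rewrite sE; lia.
  by apply: contraPneq sE => ->; rewrite hmg0 size_poly0.
move=> size_u size_v uv0.
have [u0|u0] := eqVneq u 0.
  split=> //; have [//|v0] := eqVneq v 0.
  have [_] := op_neq0 _ _ _ _ H2_symb h2_neq0 v0.
  by move: uv0; rewrite u0 (op_linear0 H1_lin) add0r => ->; rewrite eqxx.
have [size_Hu Hu0] := op_neq0 _ _ _ _ H1_symb h1_neq0 u0.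
have [v0|v0] := eqVneq v 0.
  by move: uv0 Hu0; rewrite v0 (op_linear0 H2_lin) addr0 => ->; rewrite eqxx.
have [size_Hv Hv0] := op_neq0 _ _ _ _ H2_symb h2_neq0 v0.
have HuE : H1 u = - H2 v by apply/eqP; rewrite -subr_eq0 opprK uv0.
have [su ru0] := symb_top u0; have [sv rv0] := symb_top v0.
have /esym := symb_size_eq (H1_symb su) (mulf_neq0 h1_neq0 ru0).
have /esym := symb_size_eq (H2_symb sv) (mulf_neq0 h2_neq0 rv0).
have -> : size (hmg (H1 u)) = size (hmg (H2 v)) by rewrite HuE; exact: size_hmgN.
move=> <- [degE]; have := symbD (H1_symb su) _.
rewrite degE => /(_ _ _ (H2_symb sv)); rewrite uv0 => -[_].
rewrite hmg0 coef0 => /esym/(coprimep_syzygy h_coprime size_h2)[r [rE _]].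
have := size_coef_hmg u (size (hmg u)).-1; rewrite -lead_coefE rE leqNgt.
have r0 : r != 0 by apply: contraNneq ru0 => r0; rewrite rE r0 mulr0.
rewrite size_mul // size_h2 prednK ?size_hmg_gt0 //.
by rewrite (leq_ltn_trans size_u) // !addSn /= ltnS leq_addr.
Qed.

Local Notation e0 := (a + b).+1.
Local Notation I := (mindices b + mindices a)%type.

(** The images of the low-degree monomials. They have degree at most [a + b] and, by strictness,
    span all elements of that degree in [H1 K + H2 K]. *)
Definition koszul_relation (i : I) : K :=
  match i with inl j => H1 (monJ F j) | inr j => H2 (monJ F j) end.

Lemma koszul_relation_sum (v : I -> F) : \sum_i cst (v i) * koszul_relation i =
  H1 (\sum_j cst (v (inl j)) * monJ F j) + H2 (\sum_j cst (v (inr j)) * monJ F j).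
Proof.
rewrite big_sumType /= (op_linear_sum _ _ _ H1_lin).
by rewrite (op_linear_sum _ _ _ H2_lin).
Qed.

Lemma cof_comb e (J : finType) (c : J -> F) (q : J -> K) (j : mindices e) :
  cof (\sum_i cst (c i) * q i) j = \sum_i c i * cof (q i) j.
Proof.
rewrite /cof hmg_sum !coef_sum; apply: eq_bigr => i _.
by rewrite hmgM hmg_cst !coefCM.
Qed.

Lemma cof_linear e (j : mindices e) : form_linear (fun q : K => cof q j).
Proof. by move=> c p q; rewrite /cof hmgD hmgM hmg_cst !coefD !coefCM. Qed.

Lemma size_hmg_comb e (J : finType) (c : J -> F) (q : J -> K) :
  (forall j, (size (hmg (q j)) <= e)%N) -> (size (hmg (\sum_j cst (c j) * q j)) <= e)%N.
Proof.
move=> size_q; rewrite hmg_sum; apply: leq_trans (size_sum _ _ _) _.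
apply/bigmax_leqP => j _; rewrite hmgM hmg_cst mul_polyC.
by apply: leq_trans (size_scale_leq _ _) _.
Qed.

Lemma cof_monJ e (i j : mindices e) : cof (monJ F i) j = (i == j)%:R.
Proof.
rewrite /cof hmg_mon -1?ltnS // coefCM coefXn.
case: i j => [m i] [m' j]; rewrite /= -tag_eqE /tag_eq /= (inj_eq (@ord_inj e)).
have [mE|] := eqVneq m' m; last by rewrite mulr0 coef0.
by subst m'; rewrite mulr1 coefXn tagged_asE eq_sym.
Qed.

Lemma size_koszul_relation i : (size (hmg (koszul_relation i)) <= e0)%N.
Proof.
case: i => j /=; have sj := symb_mon F (ltn_ord (tagged j) : (tagged j <= tag j)%N).
  by have [sE _] := H1_symb sj; apply: leq_trans sE _; have := ltn_ord (tag j); lia.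
by have [sE _] := H2_symb sj; apply: leq_trans sE _; have := ltn_ord (tag j); lia.
Qed.

Lemma cof_eq0 e (q : K) : (size (hmg q) <= e)%N -> (forall j : mindices e, cof q j = 0) -> q = 0.
Proof.
by move=> /hmg_coords {2}-> q0; rewrite big1 // => j _; rewrite q0 !rmorph0 mul0r.
Qed.

Lemma koszul_relation_inj (v : I -> F) :
  (forall j : mindices e0, \sum_i v i * cof (koszul_relation i) j = 0) -> forall i, v i = 0.
Proof.
move=> v0; have := koszul_relation_sum v.
set u1 := \sum_(j : mindices b) _; set u2 := \sum_(j : mindices a) _ => uE.
have size_u1 : (size (hmg u1) <= b)%N by apply: size_hmg_comb => j; exact: size_hmg_monJ.
have size_u2 : (size (hmg u2) <= a)%N by apply: size_hmg_comb => j; exact: size_hmg_monJ.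
have w0 : H1 u1 + H2 u2 = 0.
  rewrite -uE; apply: (@cof_eq0 e0); first exact/size_hmg_comb/size_koszul_relation.
  by move=> j; rewrite cof_comb v0.
have [u10 u20] := koszul_inj size_u1 size_u2 w0.
have cof0 e (j : mindices e) : cof (0 : K) j = 0 by rewrite /cof hmg0 !coef0.
have delta e (c : mindices e -> F) j : \sum_i c i * cof (monJ F i) j = c j.
  rewrite (bigD1 j) //= cof_monJ eqxx mulr1 big1 ?addr0 // => i /negPf ij.
  by rewrite cof_monJ ij mulr0.
by case=> j; rewrite -(delta _ (fun j => v (_ j))) -cof_comb -/u1 -/u2 ?u10 ?u20 cof0.
Qed.

Lemma form_eq_annihilator g g' : form_linear g -> form_linear g' ->
  (forall q, g (H1 q) = g' (H1 q)) -> (forall q, g (H2 q) = g' (H2 q)) ->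
  (forall j : mindices e0, g (monJ F j) = g' (monJ F j)) -> g =1 g'.
Proof.
move=> gl gl' g1 g2 gm q; have [w [q1 [q2 [-> size_w]]]] := koszul_reduce q.
rewrite !(form_linearD _ _ gl) !(form_linearD _ _ gl') g1 g2 (hmg_coords size_w).
rewrite (form_linear_sum _ _ _ gl) (form_linear_sum _ _ _ gl').
by congr (_ + _ + _); apply: eq_bigr => j _; rewrite gm.
Qed.

Definition reduces (q w : K) := exists q1 q2, q = w + H1 q1 + H2 q2.

(** The value at [q] is read off an arbitrary reduction of [q] to degree at most [a + b]. Two
    reductions differ by an element of [H1 K + H2 K] of low degree, a combination of
    [koszul_relation] by [koszul_strict], on which [g0] vanishes. *)
Lemma form_extend (g0 : mindices e0 -> F) :
  (forall i, \sum_j cof (koszul_relation i) j * g0 j = 0) ->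
  exists g, [/\ form_linear g, forall q, g (H1 q) = 0, forall q, g (H2 q) = 0
    & forall j, g (monJ F j) = g0 j].
Proof.
move=> g00.
(* A remainder together with its two cofactors makes reducibility a decidable predicate, to which
   [xchoose] applies. *)
pose is_red q (t : K * K * K) :=
  (q == t.1.1 + H1 t.1.2 + H2 t.2) && (size (hmg t.1.1) <= e0)%N.
have redP q : exists t, is_red q t.
  have [w [q1 [q2 [qE size_w]]]] := koszul_reduce q.
  by exists (w, q1, q2); rewrite /is_red /= -qE eqxx.
pose g1 (w : K) := \sum_j cof w j * g0 j.
have g1_lin : form_linear g1.
  move=> c p q; rewrite /g1 mulr_sumr -big_split /=; apply: eq_bigr => j _.
  by rewrite cof_linear mulrDl mulrA.
have g1_null w : (size (hmg w) <= e0)%N -> (exists u v, w = H1 u + H2 v) -> g1 w = 0.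
  move=> size_w [u [v wE]]; rewrite wE in size_w *.
  have [u' [v' [/hmg_coords u'E /hmg_coords v'E <-]]] := koszul_strict size_w.
  pose c (i : I) := match i with inl j => cof u' j | inr j => cof v' j end.
  rewrite u'E v'E -(koszul_relation_sum c) (form_linear_sum _ _ _ g1_lin) big1 // => i _.
  by rewrite /g1 g00 mulr0.
pose g q := g1 (xchoose (redP q)).1.1.
have gE q w : reduces q w -> (size (hmg w) <= e0)%N -> g q = g1 w.
  move=> [q1 [q2 qE]] size_w; rewrite /g; move: (xchooseP (redP q)).
  case: (xchoose _) => [[w' q1'] q2'] /andP[/= /eqP qE' size_w'].
  apply/eqP; rewrite -subr_eq0 -(form_linearB _ _ g1_lin); apply/eqP/g1_null.
    by rewrite hmgD hmgN (leq_trans (size_polyD _ _)) // size_polyN geq_max size_w'.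
  exists (q1 - q1'), (q2 - q2'); rewrite (op_linearB _ _ H1_lin) (op_linearB _ _ H2_lin).
  have -> : w' = q - H1 q1' - H2 q2' by rewrite {1}qE'; ring.
  by rewrite qE; ring.
exists g; split.
- move=> c p q; rewrite [g p]/g [g q]/g.
  move: (xchooseP (redP p)) (xchooseP (redP q)).
  case: (xchoose _) => [[w q1] q2] /andP[/= /eqP pE size_w].
  case: (xchoose _) => [[w' q1'] q2'] /andP[/= /eqP qE size_w'].
  rewrite -g1_lin; apply: gE; last first.
    rewrite hmgD hmgM hmg_cst mul_polyC (leq_trans (size_polyD _ _)) // geq_max size_w'.
    by rewrite (leq_trans (size_scale_leq _ _)).
  exists (cst c * q1 + q1'), (cst c * q2 + q2').
  by rewrite H1_lin H2_lin [in LHS]pE [in LHS]qE; ring.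
- move=> q; rewrite (gE _ 0) ?hmg0 ?size_poly0 //; first exact: form_linear0.
  by exists q, 0; rewrite (op_linear0 H2_lin) add0r addr0.
- move=> q; rewrite (gE _ 0) ?hmg0 ?size_poly0 //; first exact: form_linear0.
  by exists 0, q; rewrite (op_linear0 H1_lin) add0r add0r.
- move=> j; rewrite (gE _ (monJ F j)) ?size_hmg_monJ //; last first.
    by exists 0, 0; rewrite (op_linear0 H1_lin) (op_linear0 H2_lin) !addr0.
  rewrite /g1 (bigD1 j) //= cof_monJ eqxx mul1r big1 ?addr0 // => i.
  by rewrite eq_sym cof_monJ => /negPf ->; rewrite mul0r.
Qed.

(** The dual of [K / (H1 K + H2 K)]: restriction to degree at most [a + b] identifies it with the
    kernel of the independent conditions [koszul_relation], whose dimension is [codim_count]. *)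
Theorem annihilator_basis : exists G : 'I_(a.+1 * b.+1) -> K -> F,
  [/\ forall l, [/\ form_linear (G l), forall q, G l (H1 q) = 0 & forall q, G l (H2 q) = 0],
      forall lam, (forall q, \sum_l lam l * G l q = 0) -> forall l, lam l = 0
    & forall g, form_linear g -> (forall q, g (H1 q) = 0) -> (forall q, g (H2 q) = 0) ->
      exists lam, forall q, g q = \sum_l lam l * G l q].
Proof.
have cardE : (a.+1 * b.+1 + #|{: I}|)%N = #|{: mindices e0}| by rewrite card_sum codim_count.
have [G0 [G0null G0free G0span]] := family_null_basis koszul_relation_inj cardE.
have [G GP] := fin_all_exists (fun l => form_extend (G0null l)).
exists G; split=> [l|lam lam0|g gl g1 g2].
- by have [] := GP l.
- apply: G0free => j; rewrite -[RHS](lam0 (monJ F j)).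
  by apply: eq_bigr => l _; have [_ _ _ ->] := GP l.
- have [|lam lamE] := G0span (fun j => g (monJ F j)).
    move=> i; rewrite -(form_linear_sum _ _ _ gl) -hmg_coords ?size_koszul_relation //.
    by case: i => j /=; rewrite ?g1 ?g2.
  exists lam => q; apply: (form_eq_annihilator (g' := fun q => \sum_l lam l * G l q) gl) => //.
  + move=> c p p'; rewrite mulr_sumr -big_split /=; apply: eq_bigr => l _.
    by have [-> _ _ _] := GP l; ring.
  + by move=> p; rewrite g1 big1 // => l _; have [_ -> _ _] := GP l; rewrite mulr0.
  + by move=> p; rewrite g2 big1 // => l _; have [_ _ -> _] := GP l; rewrite mulr0.
  + by move=> j; rewrite lamE; apply: eq_bigr => l _; have [_ _ _ ->] := GP l.
Qed.
End Koszul.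

(** * Euler equations and linear forms *)

Section MultiIndex.
Variable n : nat.
Implicit Types a u : mindex n.

Definition madd a u : mindex n := [ffun j => (a j + u j)%N].
Definition mzero : mindex n := [ffun => 0%N].

Lemma mdeg_madd a u : mdeg (madd a u) = (mdeg a + mdeg u)%N.
Proof. by rewrite /mdeg -big_split; apply: eq_bigr => j _; rewrite ffunE. Qed.

Lemma mdeg_maddu a j : mdeg (maddu a j) = (mdeg a).+1.
Proof.
rewrite /mdeg (bigD1 j) // [in RHS](bigD1 j) //= ffunE eqxx addn1 addSn.
by congr (_ + _).+1; apply: eq_bigr => i /negPf ij; rewrite ffunE ij addn0.
Qed.

Lemma madd0 a : madd a mzero = a.
Proof. by apply/ffunP => i; rewrite !ffunE addn0. Qed.

Lemma maddC a u : madd a u = madd u a.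
Proof. by apply/ffunP => i; rewrite !ffunE addnC. Qed.

Lemma madduC a i j : maddu (maddu a i) j = maddu (maddu a j) i.
Proof. by apply/ffunP => k; rewrite !ffunE addnAC. Qed.

Lemma mindex_ind (P : mindex n -> Prop) :
  P mzero -> (forall a j, P a -> P (maddu a j)) -> forall a, P a.
Proof.
move=> P0 PS a; have [d] := ubnP (mdeg a); elim: d a => // d IH a.
have [/eqP|] := posnP (mdeg a).
  rewrite sum_nat_eq0 => /forallP a0 _.
  by rewrite (_ : a = mzero) //; apply/ffunP => j; rewrite ffunE; apply/eqP/a0.
rewrite lt0n sum_nat_eq0 negb_forall => /existsP[j /= aj].
have aE : a = maddu (msubu a j) j.
  apply/ffunP => i; rewrite !ffunE subnK //.
  by case: eqP => // ->; rewrite lt0n.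
by rewrite aE mdeg_maddu ltnS => /IH /PS.
Qed.
End MultiIndex.

Section MonomialPower.
Variables (F : fieldType) (n : nat) (p : 'I_n -> F).

Definition mpow (u : mindex n) : F := \prod_j p j ^+ u j.

Lemma mpow0 : mpow (mzero n) = 1.
Proof. by rewrite /mpow big1 // => j _; rewrite ffunE. Qed.

Lemma mpow_madd a u : mpow (madd a u) = mpow a * mpow u.
Proof. by rewrite /mpow -big_split; apply: eq_bigr => j _; rewrite ffunE exprD. Qed.

Lemma mpow_maddu a j : mpow (maddu a j) = p j * mpow a.
Proof.
rewrite /mpow (bigD1 j) //= [in RHS](bigD1 j) //= ffunE eqxx addn1 exprS mulrA.
by congr (_ * _); apply: eq_bigr => i /negPf ij; rewrite ffunE ij addn0.
Qed.

Lemma mpow_neq0 u : (forall j, p j != 0) -> mpow u != 0.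
Proof. by move=> p0; apply/prodf_neq0 => j _; rewrite expf_neq0. Qed.
End MonomialPower.

Section Shift.
Variable F : fieldType.
Local Notation K := {poly {poly F}}.
Local Notation cst c := (c%:P%:P : K).

Lemma symb_s : symb 1 ('X : K) 'X.
Proof. by have := symb_mon F (leqnn 1); rewrite /mon mul1r. Qed.

Lemma symb_t : symb 1 ('X%:P : K) 1.
Proof. by have := symb_mon F (leq0n 1); rewrite /mon mulr1. Qed.

Definition shift (g1 g2 : F) (q : K) : K :=
  map_poly (comp_poly ('X - g2%:P)) q \Po ('X - cst g1).

HB.instance Definition _ g1 g2 := GRing.RMorphism.copy (shift g1 g2)
  (comp_poly ('X - cst g1) \o map_poly (comp_poly ('X - g2%:P))).

Lemma shift_cst g1 g2 c : shift g1 g2 (cst c) = cst c.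
Proof. by rewrite /shift map_polyC /= !comp_polyC. Qed.

Lemma shift_s g1 g2 : shift g1 g2 'X = 'X - cst g1.
Proof. by rewrite /shift map_polyX comp_polyX. Qed.

Lemma shift_t g1 g2 : shift g1 g2 'X%:P = 'X%:P - cst g2.
Proof. by rewrite /shift map_polyC /= comp_polyX comp_polyC rmorphB. Qed.

Lemma shift_linear g1 g2 : op_linear (shift g1 g2).
Proof. by move=> c p q; rewrite rmorphD rmorphM /= shift_cst. Qed.

Lemma shift_mon g1 g2 m i :
  shift g1 g2 (mon F m i) = ('X%:P - cst g2) ^+ (m - i) * ('X - cst g1) ^+ i.
Proof. by rewrite /mon rmorphM !rmorphXn /= shift_s shift_t. Qed.

Lemma shiftC g1 g2 g1' g2' q :
  shift g1 g2 (shift g1' g2' q) = shift g1' g2' (shift g1 g2 q).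
Proof.
rewrite (hmg_coords (leqnn (size (hmg q)))).
rewrite !(op_linear_sum _ _ _ (shift_linear _ _)); apply: eq_bigr => j _.
have shift_prod g g' h h' k l : shift g g' (('X%:P - cst h') ^+ k * ('X - cst h) ^+ l) =
    ('X%:P - cst g' - cst h') ^+ k * ('X - cst g - cst h) ^+ l.
  rewrite (rmorphM (shift g g')) (rmorphXn (shift g g')) (rmorphXn (shift g g')).
  by rewrite !(rmorphB (shift g g')) /= !shift_cst shift_s shift_t.
congr (_ * _); rewrite /monJ !shift_mon !shift_prod.
by rewrite addrAC [X in _ * (X ^+ _) = _]addrAC.
Qed.

Lemma shift00 q : shift 0 0 q = q.
Proof.
rewrite /shift !subr0 comp_polyXr map_poly_id // => r _.
by rewrite comp_polyXr.
Qed.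

(** A translation alters only terms of lower degree: this is visible on the generators s and t,
    hence on monomials. *)
Lemma shift_symb g1 g2 m q r : symb m q r -> symb m (shift g1 g2 q) r.
Proof.
have low c : symb 1 (cst c) 0 by have [size_c _] := symb_cst c; exact: symb_low.
have s1 : symb 1 (shift g1 g2 ('X : K)) 'X.
  by have := symbB symb_s (low g1); rewrite subr0 -(shift_s g1 g2).
have s2 : symb 1 (shift g1 g2 ('X%:P : K)) 1.
  by have := symbB symb_t (low g2); rewrite subr0 -(shift_t g1 g2).
have s3 k i : (i <= k)%N -> symb k (shift g1 g2 (mon F k i)) 'X^i.
  move=> ik; rewrite /mon rmorphM !rmorphXn /= -[k in symb k](subnK ik).
  by have := symbM (symbX (k - i) s2) (symbX i s1); rewrite !muln1 expr1n mul1r.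
have s4 k (r' : {poly F}) : (size r' <= k.+1)%N -> symb k (shift g1 g2 (lift k r')) r'.
  move=> size_r; rewrite /lift rmorph_sum.
  rewrite [X in symb _ _ X](_ : r' = \sum_(i < k.+1) (r'`_i)%:P * 'X^i).
    apply: symb_sum => i _; rewrite rmorphM /= shift_cst; apply: symbZ.
    by apply: s3; rewrite -ltnS.
  under eq_bigr => i _ do rewrite mul_polyC.
  rewrite -poly_def; apply/polyP => i; rewrite coef_poly; case: ltnP => // im.
  by rewrite nth_default // (leq_trans size_r).
have s5 k q' : (size (hmg q') <= k)%N -> (size (hmg (shift g1 g2 q')) <= k)%N.
  move=> /hmg_expand ->; rewrite rmorph_sum hmg_sum (leq_trans (size_sum _ _ _)) //.
  apply/bigmax_leqP => i _; have [size_i _] := s4 i _ (size_coef_hmg q' i).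
  by apply: leq_trans size_i _.
move=> [/hmg_expand qE qm]; rewrite qE big_ord_recr /= qm rmorphD /= -[X in symb _ _ X]add0r.
apply: symbD; last by apply: s4; rewrite -qm size_coef_hmg.
apply/symb_low/s5; rewrite hmg_sum (leq_trans (size_sum _ _ _)) //.
apply/bigmax_leqP => i _; rewrite hmg_lift ?size_coef_hmg //.
by apply: leq_trans (size_CXn _ _) _.
Qed.
End Shift.

Section EulerForms.
Variables (F : fieldType) (n k : nat) (e1 e2 m1 m2 : 'I_n -> F) (A : 'I_k -> 'I_n -> F).
Hypotheses (m1e1 : \sum_j m1 j * e1 j = 1) (m1e2 : \sum_j m1 j * e2 j = 0)
  (m2e1 : \sum_j m2 j * e1 j = 0) (m2e2 : \sum_j m2 j * e2 j = 1)
  (A_ker : forall w : 'I_n -> F, \sum_j w j * e1 j = 0 -> \sum_j w j * e2 j = 0 ->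
     exists y, forall j, w j = \sum_i y i * A i j).
Variable eps : F.
Local Notation K := {poly {poly F}}.
Local Notation cst c := (c%:P%:P : K).
Local Notation seqs := (mindex n -> F).
Implicit Types (a u : mindex n) (c : 'I_n -> F) (phi : seqs).

Definition ell j : K := cst (e1 j) * 'X + cst (e2 j) * 'X%:P.
Definition ell_symb j : {poly F} := (e1 j)%:P * 'X + (e2 j)%:P.

(* [eps] interpolates between the falling factorials of the Weyl algebra action
   ([eps = 1]) and the powers occurring in principal symbols ([eps = 0]). *)
Definition ff c a : K := \prod_j \prod_(i < a j) (cst (c j - eps * i%:R) + ell j).
Definition cshift c u : 'I_n -> F := fun j => c j - eps * (u j)%:R.

Lemma ff0 c : ff c (mzero n) = 1.
Proof. by rewrite /ff big1 // => j _; rewrite ffunE big_ord0. Qed.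

Lemma ff_madd c a u : ff c (madd u a) = ff c u * ff (cshift c u) a.
Proof.
rewrite /ff -big_split; apply: eq_bigr => j _ /=; rewrite ffunE big_split_ord /=.
congr (_ * _); apply: eq_bigr => i _; congr (_%:P%:P + _).
by rewrite /cshift natrD; ring.
Qed.

Lemma ff_maddu c a j : ff c (maddu a j) = (cst (c j - eps * (a j)%:R) + ell j) * ff c a.
Proof.
rewrite /ff (bigD1 j) //= [in RHS](bigD1 j) //= ffunE eqxx addn1 big_ord_recr /=.
rewrite -!mulrA mulrCA; congr (_ * (_ * _)).
by apply: eq_bigr => i /negPf ij; rewrite ffunE ij addn0.
Qed.

Lemma ell_symbP j : symb 1 (ell j) (ell_symb j).
Proof.
have := symbD (symbZ (e1 j) (@symb_s F)) (symbZ (e2 j) (@symb_t F)).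
by rewrite mulr1.
Qed.

Lemma ff_symb c a : symb (mdeg a) (ff c a) (\prod_j ell_symb j ^+ a j).
Proof.
have low (d : F) : symb 1 (cst d) 0 by have [size_c _] := symb_cst d; exact: symb_low.
apply: symb_prod => j; elim: (a j) => [|d IH].
  by rewrite big_ord0; exact: (symb_cst 1).
rewrite big_ord_recr /= exprSr.
by have := symbM IH (symbD (low (c j - eps * d%:R)) (ell_symbP j)); rewrite add0r addn1.
Qed.

Lemma shift_ell g1 g2 j : shift g1 g2 (ell j) = ell j - cst (e1 j * g1 + e2 j * g2).
Proof.
rewrite /ell rmorphD !rmorphM /= !shift_cst shift_s shift_t !polyCD !polyCM.
by ring.
Qed.

Lemma shift_ff g1 g2 c a : shift g1 g2 (ff c a) =
  ff (fun j => c j - (e1 j * g1 + e2 j * g2)) a.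
Proof.
rewrite /ff rmorph_prod; apply: eq_bigr => j _ /=; rewrite rmorph_prod.
apply: eq_bigr => i _ /=; rewrite rmorphD /= shift_cst shift_ell.
by rewrite !polyCB; ring.
Qed.

(** The polynomials [q] such that [g] kills every [q * ff c a] are stable under each [ell j], by the
    recursion for [ff]. The dual vectors [m1] and [m2] recover s and t from the [ell j], so this
    space is an ideal; it contains 1. *)
Lemma ff_span (g : K -> F) c : form_linear g -> (forall a, g (ff c a) = 0) -> g =1 fun=> 0.
Proof.
move=> gl g0.
pose P (q : K) := forall a, g (q * ff c a) = 0.
have P1 : P 1 by move=> a; rewrite mul1r.
have P0 : P 0 by move=> a; rewrite mul0r form_linear0.
have PD p q : P p -> P q -> P (p + q).
  by move=> Pp Pq a; rewrite mulrDl (form_linearD _ _ gl) Pp Pq addr0.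
have PZ (d : F) p : P p -> P (cst d * p).
  by move=> Pp a; rewrite -mulrA (form_linearZ _ _ gl) Pp mulr0.
have Pell j q : P q -> P (ell j * q).
  move=> Pq a; have := Pq (maddu a j).
  rewrite ff_maddu mulrDl mulrDr (form_linearD _ _ gl).
  rewrite [q * (cst _ * _)]mulrCA (form_linearZ _ _ gl) Pq mulr0 add0r.
  by rewrite mulrA [q * ell j]mulrC.
have Psum (I : Type) (s : seq I) (q : I -> K) : (forall i, P (q i)) -> P (\sum_(i <- s) q i).
  by move=> Pq; elim/big_ind: _.
have comb (m e : 'I_n -> F) (p : K) :
    \sum_j cst (m j) * (cst (e j) * p) = cst (\sum_j m j * e j) * p.
  by rewrite !rmorph_sum mulr_suml; apply: eq_bigr => j _; rewrite mulrA -!polyCM.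
have sE : 'X = \sum_j cst (m1 j) * ell j.
  under eq_bigr => j _ do rewrite mulrDr.
  by rewrite big_split /= !comb m1e1 m1e2 mul1r mul0r addr0.
have tE : 'X%:P = \sum_j cst (m2 j) * ell j.
  under eq_bigr => j _ do rewrite mulrDr.
  by rewrite big_split /= !comb m2e1 m2e2 mul1r mul0r add0r.
have Ps q : P q -> P ('X * q).
  move=> Pq; rewrite sE mulr_suml; apply: Psum => j.
  by rewrite -mulrA; apply/PZ/Pell.
have Pt q : P q -> P ('X%:P * q).
  move=> Pq; rewrite tE mulr_suml; apply: Psum => j.
  by rewrite -mulrA; apply/PZ/Pell.
have Pmon m i : P (mon F m i).
  have Pti : P ('X%:P ^+ (m - i)).
    by elim: (m - i)%N => // d IH; rewrite exprS; apply: Pt.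
  rewrite /mon rmorphXn /= mulrC; move: (_ ^+ (m - i)) Pti => r Pr.
  by elim: i => [|i IH]; rewrite ?mul1r // exprS -mulrA; apply: Ps.
move=> q; rewrite (hmg_coords (leqnn (size (hmg q)))).
rewrite (form_linear_sum _ _ _ gl) big1 // => j _.
by have := Pmon (tag j) (tagged j) (mzero n); rewrite ff0 mulr1 => ->; rewrite mulr0.
Qed.
(** If [phi a = gam (ff c a)] for a linear form [gam], then [eta c j phi a = gam (ell j * ff c a)]:
    this is multiplication by [ell j] seen on sequences. Accordingly [opS] and [opT] below play the
    roles of s and t. *)
Definition eta c j phi : seqs :=
  fun a => phi (maddu a j) + (eps * (a j)%:R - c j) * phi a.
Definition euler c phi := forall i a, \sum_j A i j * eta c j phi a = 0.

Lemma etaC c i j phi : eta c i (eta c j phi) = eta c j (eta c i phi).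
Proof.
apply: functional_extensionality => a; rewrite /eta madduC !ffunE eq_sym.
by case: eqP => [->|_]; rewrite ?addn0 ?addn1; ring.
Qed.

Lemma eta_lin c j (I : Type) (s : seq I) (w : I -> F) (f : I -> seqs) a :
  eta c j (fun b => \sum_(i <- s) w i * f i b) a = \sum_(i <- s) w i * eta c j (f i) a.
Proof. by rewrite /eta mulr_sumr -big_split; apply: eq_bigr => i _ /=; ring. Qed.

Lemma euler_eta c j phi : euler c phi -> euler c (eta c j phi).
Proof.
move=> phiE i a; under eq_bigr => l _ do rewrite etaC.
by rewrite -(eta_lin c j _ (A i) (fun l => eta c l phi)) /eta !phiE; ring.
Qed.

Definition opS c phi : seqs := fun a => \sum_j m1 j * eta c j phi a.
Definition opT c phi : seqs := fun a => \sum_j m2 j * eta c j phi a.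

Lemma opSTC c phi : opS c (opT c phi) = opT c (opS c phi).
Proof.
apply: functional_extensionality => a; rewrite /opS /opT.
under eq_bigr => j _ do rewrite (eta_lin c j _ m2 (fun l => eta c l phi)) mulr_sumr.
under [RHS]eq_bigr => j _ do rewrite (eta_lin c j _ m1 (fun l => eta c l phi)) mulr_sumr.
rewrite exchange_big; apply: eq_bigr => i _; apply: eq_bigr => j _ /=.
by rewrite etaC mulrCA.
Qed.

(** At a fixed [a], the vector of the values [eta c l phi a] is orthogonal to the rows of [A]. The
    vector [w], which measures the failure of the claimed identity, is orthogonal to [e1] and [e2],
    so it is a combination of those rows. *)
Lemma euler_opST c phi j a : euler c phi ->
  e1 j * opS c phi a + e2 j * opT c phi a = eta c j phi a.
Proof.
move=> phiE; pose w l := e1 j * m1 l + e2 j * m2 l - (l == j)%:R.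
have delta (f : 'I_n -> F) : \sum_l (l == j)%:R * f l = f j.
  by rewrite (bigD1 j) //= eqxx mul1r big1 ?addr0 // => l /negPf ->; rewrite mul0r.
have wE (f : 'I_n -> F) : \sum_l w l * f l =
    e1 j * (\sum_l m1 l * f l) + e2 j * (\sum_l m2 l * f l) - f j.
  rewrite -[f j in RHS]delta !mulr_sumr -big_split -sumrB /=.
  by apply: eq_bigr => l _; rewrite /w; ring.
have [||y yE] := A_ker (w := w); rewrite ?wE ?m1e1 ?m1e2 ?m2e1 ?m2e2; try by ring.
apply/eqP; rewrite -subr_eq0 -wE; apply/eqP.
under eq_bigr => l _ do rewrite yE mulr_suml.
rewrite exchange_big big1 // => i _ /=.
by under eq_bigr => l _ do rewrite -mulrA; rewrite -mulr_sumr phiE mulr0.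
Qed.

(* Formally [eval_form c phi q = (q(S, T) phi)(0)] for the commuting operators
   [S = opS c] and [T = opT c]. *)
Definition eval_form c phi (q : K) : F :=
  \sum_(i < size q) \sum_(k < size q`_i) q`_i`_k * iter i (opS c) (iter k (opT c) phi) (mzero n).

(** The truncation bound does not depend on [phi], so evaluations at several polynomials and
    sequences can be compared term by term. *)
Lemma eval_form_widen c (q : K) : exists N0, forall N N', (N0 <= N)%N -> (N0 <= N')%N ->
  forall phi,
  eval_form c phi q =
  \sum_(i < N) \sum_(k < N') q`_i`_k * iter i (opS c) (iter k (opT c) phi) (mzero n).
Proof.
exists (maxn (size q) (\max_(i < size q) size (q`_i)%R)) => N N'.
rewrite !geq_max => /andP[sN _] /andP[_ /bigmax_leqP mN] phi.
rewrite /eval_form (big_ord_widen N (fun i => \sum_(k < size q`_i) q`_i`_k *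
  iter i (opS c) (iter k (opT c) phi) (mzero n))) // big_mkcond.
apply: eq_bigr => i _; case: ltnP => iq; last first.
  by rewrite big1 // => l _; rewrite (nth_default 0 iq) coef0 mul0r.
rewrite (big_ord_widen N' (fun k => q`_i`_k * iter i (opS c) (iter k (opT c) phi) (mzero n))).
  rewrite big_mkcond; apply: eq_bigr => l _; case: ltnP => // kq.
  by rewrite (nth_default 0 kq) mul0r.
exact: (mN (Ordinal iq)).
Qed.

Lemma eval_form_linear c phi : form_linear (eval_form c phi).
Proof.
move=> d p q; have [Np pE] := eval_form_widen c p; have [Nq qE] := eval_form_widen c q.
have [N NE] := eval_form_widen c (cst d * p + q).
pose M := maxn N (maxn Np Nq).
rewrite (NE M M) ?(pE M M) ?(qE M M) ?leq_max ?leqnn ?orbT //.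
rewrite mulr_sumr -big_split; apply: eq_bigr => i _ /=.
rewrite mulr_sumr -big_split; apply: eq_bigr => k' _ /=.
by rewrite !coefD !coefCM; ring.
Qed.

Lemma eval_form_comb c (I : Type) (s : seq I) (w : I -> F) (f : I -> seqs) q :
  eval_form c (fun b => \sum_(i <- s) w i * f i b) q = \sum_(i <- s) w i * eval_form c (f i) q.
Proof.
have opE (m : 'I_n -> F) (g : I -> seqs) :
    (fun a => \sum_j m j * eta c j (fun b => \sum_(i <- s) w i * g i b) a) =
    (fun a => \sum_(i <- s) w i * (\sum_j m j * eta c j (g i) a)).
  apply: functional_extensionality => a.
  under eq_bigr => j _ do rewrite eta_lin mulr_sumr.
  rewrite exchange_big; apply: eq_bigr => i _ /=; rewrite mulr_sumr.
  by apply: eq_bigr => j _; rewrite mulrCA.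
have iterT d : iter d (opT c) (fun b => \sum_(i <- s) w i * f i b) =
    fun b => \sum_(i <- s) w i * iter d (opT c) (f i) b.
  by elim: d => //= d ->; exact: opE.
have iterS d (g : I -> seqs) : iter d (opS c) (fun b => \sum_(i <- s) w i * g i b) =
    fun b => \sum_(i <- s) w i * iter d (opS c) (g i) b.
  by elim: d => //= d ->; exact: opE.
rewrite /eval_form; under [RHS]eq_bigr => l _ do rewrite mulr_sumr.
rewrite exchange_big; apply: eq_bigr => i _ /=.
under [RHS]eq_bigr => l _ do rewrite mulr_sumr.
rewrite exchange_big; apply: eq_bigr => k' _ /=.
rewrite iterT (iterS _ (fun i => iter k' (opT c) (f i))) mulr_sumr.
by apply: eq_bigr => l _; rewrite mulrCA.
Qed.

Lemma eval_formS c phi q : eval_form c phi ('X * q) = eval_form c (opS c phi) q.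
Proof.
have [N NE] := eval_form_widen c ('X * q); have [Nq qE] := eval_form_widen c q.
pose M := maxn N Nq; have MN : (N <= M)%N by rewrite leq_max leqnn.
have iterTS d psi : iter d (opT c) (opS c psi) = opS c (iter d (opT c) psi).
  by elim: d => //= d ->; rewrite opSTC.
rewrite (NE M.+1 M) ?(leqW MN) // (qE M M) ?leq_max ?leqnn ?orbT // big_ord_recl /=.
rewrite big1 ?add0r => [|k' _]; last by rewrite coefXM /= coef0 mul0r.
apply: eq_bigr => i _ /=; apply: eq_bigr => k' _.
by rewrite coefXM /= -iterS iterSr iterTS.
Qed.

Lemma eval_formT c phi q : eval_form c phi ('X%:P * q) = eval_form c (opT c phi) q.
Proof.
have [N NE] := eval_form_widen c ('X%:P * q); have [Nq qE] := eval_form_widen c q.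
pose M := maxn N Nq; have MN : (N <= M)%N by rewrite leq_max leqnn.
rewrite (NE M M.+1) ?(leqW MN) // (qE M M) ?leq_max ?leqnn ?orbT //.
apply: eq_bigr => i _ /=; rewrite big_ord_recl coefCM coefXM /= mul0r add0r.
by apply: eq_bigr => k' _; rewrite coefXM /= -iterS iterSr.
Qed.

Lemma eval_form1 c phi : eval_form c phi 1 = phi (mzero n).
Proof. by rewrite /eval_form size_poly1 big_ord1 coefC /= size_poly1 big_ord1 coefC /= mul1r. Qed.

(** The last factor of [ff c (maddu a j)] is moved from the polynomial to the sequence, and the
    induction hypothesis is used for a new sequence; hence the quantification over [phi] in the
    induction. *)
Theorem eval_form_ff c phi a : euler c phi -> eval_form c phi (ff c a) = phi a.
Proof.
elim/mindex_ind: a phi => [|a j IH] phi phiE; first by rewrite ff0 eval_form1.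
rewrite ff_maddu mulrDl /ell mulrDl -!mulrA.
rewrite !(form_linearD _ _ (eval_form_linear c phi)).
rewrite !(form_linearZ _ _ (eval_form_linear c phi)) eval_formS eval_formT.
pose psi := nth phi [:: phi; opS c phi; opT c phi].
pose w := nth 0 [:: c j - eps * (a j)%:R; e1 j; e2 j].
have -> : (c j - eps * (a j)%:R) * eval_form c phi (ff c a) +
    (e1 j * eval_form c (opS c phi) (ff c a) + e2 j * eval_form c (opT c phi) (ff c a)) =
    \sum_(i < 3) w i * eval_form c (psi i) (ff c a).
  by rewrite !big_ord_recl big_ord0 /w /psi /= addr0.
rewrite -eval_form_comb.
(* The new sequence is [eta c j phi] plus the constant multiple [c j - eps * a j] of [phi]. It again
   satisfies the Euler equations, and at [a] the constants cancel, leaving [phi (maddu a j)]. *)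
have psiE : (fun b => \sum_(i < 3) w i * psi i b) =
    fun b => \sum_(i < 2) [:: c j - eps * (a j)%:R; 1]`_i * nth phi [:: phi; eta c j phi] i b.
  apply: functional_extensionality => b.
  by rewrite !big_ord_recl !big_ord0 /= !addr0 mul1r -(euler_opST j b phiE).
rewrite psiE IH => [|l b].
  by rewrite !big_ord_recl big_ord0 /= /eta; ring.
under eq_bigr => i _ do rewrite eta_lin mulr_sumr.
rewrite exchange_big big1 // => i _ /=.
under eq_bigr => i' _ do rewrite mulrCA.
rewrite -mulr_sumr (_ : \sum_i' _ = 0) ?mulr0 //.
by case: i => [[|[|//]] ?] /=; [apply: phiE|apply: (euler_eta j phiE)].
Qed.
End EulerForms.

(** * Generic coprimality of two pencils *)

(** Surviving leading coefficients keep both degrees, hence the shape of the Sylvester matrix. *)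
Lemma rmorph_resultant (R S : nzRingType) (f : {rmorphism R -> S}) p q :
    f (lead_coef p) != 0 -> f (lead_coef q) != 0 ->
  f (resultant p q) = resultant (map_poly f p) (map_poly f q).
Proof.
move=> p0 q0; rewrite /resultant /Sylvester_mx !size_map_poly_id0 // -det_map_mx map_col_mx.
by congr (\det (col_mx _ _)); apply: map_lin1_mx => v; rewrite map_poly_rV rmorphM /= map_rVpoly.
Qed.

Section Pencil.
Variable C : closedFieldType.
Implicit Types (X Y P : {poly C}) (z : nat -> C).

Lemma injective_avoid z (s : seq C) : injective z -> exists k, z k \notin s.
Proof.
move=> z_inj; have [/allP zs|] := boolP (all (fun k => z k \in s) (iota 0 (size s).+1)).
  have : (size (map z (iota 0 (size s).+1)) <= size s)%N.
    by apply: uniq_leq_size => [|_ /mapP[k kI ->]]; rewrite ?map_inj_uniq ?iota_uniq ?zs.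
  by rewrite size_map size_iota ltnn.
by case/allPn => k _ ks; exists k.
Qed.

Lemma root_seq P : P != 0 -> exists s : seq C, forall r, root P r -> r \in s.
Proof.
move=> P0; have [s PE] := closed_field_poly_normal P; exists s => r.
by rewrite PE rootZ ?lead_coef_eq0 // root_prod_XsubC.
Qed.

Lemma coprimep_no_root P Q : (forall r, root P r -> root Q r -> False) -> coprimep P Q.
Proof.
move=> PQ; rewrite /coprimep; apply/idPn => /closed_rootP[r].
by rewrite root_gcd => /andP[]; exact: PQ.
Qed.

Lemma size_pencil X Y d t : size X = d.+1 -> size Y = d.+1 -> t != X`_d / Y`_d ->
  size (X - t *: Y) = d.+1.
Proof.
move=> sX sY tXY; apply/eqP; rewrite eqn_leq; apply/andP; split.
  rewrite (leq_trans (size_polyD _ _)) // size_polyN geq_max sX leqnn /= -sY.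
  exact: size_scale_leq.
rewrite ltnNge; apply/negP => /leq_sizeP/(_ d (leqnn d)).
rewrite coefB coefZ => /eqP; rewrite subr_eq0 => /eqP XE.
have Y0 : Y`_d != 0 by rewrite -[d]/(d.+1.-1) -sY -lead_coefE lead_coef_eq0 -size_poly_gt0 sY.
by case/eqP: tXY; rewrite XE mulfK.
Qed.

(** Members are chosen in turn: [z k] avoids the finitely many ratios of [X1] to [Y1] at roots of
    [X2], and [z l] those of [X2] to [Y2] at roots of the chosen first member. A common root then
    annihilates [Y2] and [X2], and so [Y1] and [X1]. *)
Lemma pencil_coprime X1 Y1 X2 Y2 d1 d2 z : injective z ->
  size X1 = d1.+1 -> size Y1 = d1.+1 -> size X2 = d2.+1 -> size Y2 = d2.+1 ->
  (forall r, ~ [/\ root X1 r, root Y1 r, root X2 r & root Y2 r]) ->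
  exists k l, [/\ size (X1 - z k *: Y1) = d1.+1, size (X2 - z l *: Y2) = d2.+1
    & coprimep (X1 - z k *: Y1) (X2 - z l *: Y2)].
Proof.
move=> z_inj sX1 sY1 sX2 sY2 noroot.
have [s2 s2P] : exists s : seq C, forall r, root X2 r -> r \in s.
  by apply: root_seq; rewrite -size_poly_gt0 sX2.
(* Avoiding the ratio of leading coefficients preserves the degree. Where [Y1.[r]] is 0 the quotient
   is 0 by convention, just one more value to avoid. *)
have [k] := injective_avoid ((X1`_d1 / Y1`_d1) :: [seq X1.[r] / Y1.[r] | r <- s2]) z_inj.
rewrite inE negb_or => /andP[/(size_pencil sX1 sY1) sh1 zk].
have [s1 s1P] : exists s : seq C, forall r, root (X1 - z k *: Y1) r -> r \in s.
  by apply: root_seq; rewrite -size_poly_gt0 sh1.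
have [l] := injective_avoid ((X2`_d2 / Y2`_d2) :: [seq X2.[r] / Y2.[r] | r <- s1]) z_inj.
rewrite inE negb_or => /andP[/(size_pencil sX2 sY2) sh2 zl].
exists k, l; split=> //; apply: coprimep_no_root => r r1 r2.
have /eqP := r2; rewrite /root hornerD hornerN hornerZ => /eqP; rewrite subr_eq0 => /eqP X2E.
have [Y20|Y20] := eqVneq Y2.[r] 0; last first.
  by case/negP: zl; apply/mapP; exists r; rewrite ?s1P // X2E mulfK.
have X20 : root X2 r by rewrite /root X2E Y20 mulr0.
have /eqP := r1; rewrite /root hornerD hornerN hornerZ => /eqP; rewrite subr_eq0 => /eqP X1E.
have [Y10|Y10] := eqVneq Y1.[r] 0; last first.
  by case/negP: zk; apply/mapP; exists r; rewrite ?s2P // X1E mulfK.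
by apply: (noroot r); split=> //; rewrite /root ?X1E ?Y10 ?Y20 ?mulr0.
Qed.
End Pencil.

Section GenericPoint.
Variables (C : closedFieldType) (n : nat).
Implicit Types (p : 'I_n -> C) (u : mindex n).

(** For [X] and [Y] the two products of linear forms, this is h_i with its denominators cleared, so
    that the coefficients are polynomials in [p]. *)
Definition pencil (X Y : {poly C}) u v p : {poly C} := mpow p v *: X - mpow p u *: Y.

Let gen_pow u : {mpoly C[n]} := \prod_j 'X_j ^+ u j.
Let gen_pencil (X Y : {poly C}) u v : {poly {mpoly C[n]}} :=
  gen_pow v *: map_poly (@mpolyC n C) X - gen_pow u *: map_poly (@mpolyC n C) Y.

Let meval_pow p u : (gen_pow u).@[p] = mpow p u.
Proof. by rewrite rmorph_prod; apply: eq_bigr => j _; rewrite /= rmorphXn /= mevalXU. Qed.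

Let meval_pencil X Y u v p : map_poly (meval p) (gen_pencil X Y u v) = pencil X Y u v p.
Proof.
by apply/polyP => i; rewrite coef_map /= !coefB !coefZ !coef_map /= mevalB !mevalM !mevalC !meval_pow.
Qed.

Let size_gen_pencil (X Y : {poly C}) u v d : size X = d.+1 -> size Y = d.+1 ->
  (size (gen_pencil X Y u v) <= d.+1)%N.
Proof.
move=> sX sY; rewrite (leq_trans (size_polyD _ _)) // size_polyN geq_max.
by rewrite !(leq_trans (size_scale_leq _ _)) // (leq_trans (size_poly _ _)) ?sX ?sY.
Qed.

(** The hypersurface is the product of the coordinates, the two top coefficients and the resultant
    over the ring of polynomials in [p]. It is proper because none of these factors vanishes at the
    one torus point realizing the pair from [pencil_coprime]. *)
Lemma generic_coprime (X1 Y1 X2 Y2 : {poly C}) d1 d2 u1 v1 u2 v2 (z : nat -> C) : injective z ->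
  size X1 = d1.+2 -> size Y1 = d1.+2 -> size X2 = d2.+2 -> size Y2 = d2.+2 ->
  (forall r, ~ [/\ root X1 r, root Y1 r, root X2 r & root Y2 r]) ->
  (forall k l, exists p, [/\ forall j, p j != 0, mpow p u1 = z k * mpow p v1 &
     mpow p u2 = z l * mpow p v2]) ->
  exists g : {mpoly C[n]}, g != 0 /\ forall p, g.@[p] != 0 ->
    [/\ forall j, p j != 0, size (pencil X1 Y1 u1 v1 p) = d1.+2,
        size (pencil X2 Y2 u2 v2 p) = d2.+2 &
        coprimep (pencil X1 Y1 u1 v1 p) (pencil X2 Y2 u2 v2 p)].
Proof.
move=> z_inj sX1 sY1 sX2 sY2 noroot torus.
pose k1 := gen_pencil X1 Y1 u1 v1; pose k2 := gen_pencil X2 Y2 u2 v2.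
pose g : {mpoly C[n]} := \prod_j 'X_j * (k1`_d1.+1 * k2`_d2.+1 * resultant k1 k2).
have size_k1 : (size k1 <= d1.+2)%N by apply: size_gen_pencil.
have size_k2 : (size k2 <= d2.+2)%N by apply: size_gen_pencil.
have top (k : {poly {mpoly C[n]}}) d p : (size k <= d.+1)%N -> meval p k`_d != 0 ->
    size k = d.+1 /\ size (map_poly (meval p) k) = d.+1.
  move=> sk kd; have sE : size k = d.+1.
    apply/eqP; rewrite eqn_leq sk ltnNge; apply: contraNN kd => /leq_sizeP/(_ d (leqnn d)) ->.
    by rewrite meval0.
  by split=> //; rewrite size_map_poly_id0 // lead_coefE sE.
exists g; split; last first.
  move=> p; rewrite /g mevalM !mevalM rmorph_prod !mulf_eq0 !negb_or /=.
  case/andP => /prodf_neq0 p0 /andP[/andP[k1d k2d] res0].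
  have [sk1 sk1p] := top _ _ _ size_k1 k1d; have [sk2 sk2p] := top _ _ _ size_k2 k2d.
  rewrite -!meval_pencil; split=> //; first by move=> j; rewrite -(mevalXU p j) p0.
  have := res0; rewrite rmorph_resultant ?lead_coefE ?sk1 ?sk2 // resultant_eq0.
  rewrite -leqNgt /coprimep => le1; rewrite eqn_leq le1 lt0n size_poly_eq0 gcdp_eq0.
  by rewrite -size_poly_eq0 sk1p.
have [k [l [s1 s2 cop]]] := pencil_coprime z_inj sX1 sY1 sX2 sY2 noroot.
have [p [p0 pk pl]] := torus k l.
have mpow0 u : mpow p u != 0 by apply/prodf_neq0 => j _; rewrite expf_neq0.
have E1 : map_poly (meval p) k1 = mpow p v1 *: (X1 - z k *: Y1).
  by rewrite meval_pencil /pencil pk scalerBr scalerA [z k * _]mulrC.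
have E2 : map_poly (meval p) k2 = mpow p v2 *: (X2 - z l *: Y2).
  by rewrite meval_pencil /pencil pl scalerBr scalerA [z l * _]mulrC.
have c1 : meval p k1`_d1.+1 != 0.
  rewrite -coef_map /= E1 coefZ mulf_neq0 // -[d1.+1]/(d1.+2.-1) -s1 -lead_coefE.
  by rewrite lead_coef_eq0 -size_poly_gt0 s1.
have c2 : meval p k2`_d2.+1 != 0.
  rewrite -coef_map /= E2 coefZ mulf_neq0 // -[d2.+1]/(d2.+2.-1) -s2 -lead_coefE.
  by rewrite lead_coef_eq0 -size_poly_gt0 s2.
have [sk1 sk1p] := top _ _ _ size_k1 c1; have [sk2 sk2p] := top _ _ _ size_k2 c2.
suff : g.@[p] != 0 by apply: contraNneq => ->; rewrite meval0.
rewrite /g mevalM !mevalM rmorph_prod !mulf_neq0 //.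
  by apply/prodf_neq0 => j _; rewrite /= mevalXU.
rewrite rmorph_resultant ?lead_coefE ?sk1 ?sk2 // resultant_eq0 -leqNgt E1 E2.
have := cop; rewrite -(coprimepZl _ _ (mpow0 v1)) -(coprimepZr _ _ (mpow0 v2)).
by rewrite /coprimep => /eqP ->.
Qed.
End GenericPoint.

(** * Bounds and convergence *)

Section LinearBound.
Variables (C : numFieldType) (X J : finType) (r : J -> (X -> C) -> C).
Hypothesis r_lin : forall y c v w, r y (fun x => c * v x + w x) = c * r y v + r y w.

Lemma linear_expand y v : r y v = \sum_x v x * r y (fun x' => (x' == x)%:R).
Proof.
have r0 : r y (fun=> 0) = 0.
  by have := r_lin y (-1) (fun=> 0) (fun=> 0); rewrite mulr0 addr0 mulN1r addNr.
have rsum (s : seq X) : r y (fun x' => \sum_(x <- s) v x * (x' == x)%:R) =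
    \sum_(x <- s) v x * r y (fun x' => (x' == x)%:R).
  elim: s => [|x s IH].
    by rewrite big_nil -[RHS]r0; congr (r y _); apply: functional_extensionality => x; rewrite big_nil.
  rewrite big_cons -IH -r_lin; congr (r y _).
  by apply: functional_extensionality => x'; rewrite big_cons.
rewrite -rsum; congr (r y _); apply: functional_extensionality => x'.
by rewrite (bigD1 x') //= eqxx mulr1 big1 ?addr0 // => x; rewrite eq_sym => /negPf ->; rewrite mulr0.
Qed.

(** An injective linear map between finite-dimensional spaces has a left inverse; the sum of the
    absolute values of its entries serves as [K]. *)
Lemma injective_bound : (forall v, (forall y, r y v = 0) -> forall x, v x = 0) ->
  exists K, 0 <= K /\ forall v e, 0 <= e -> (forall y, `|r y v| <= e) -> forall x, `|v x| <= K * e.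
Proof.
move=> r_inj.
have [|M' M'P] := family_left_inverse (M := fun x y => r y (fun x' => (x' == x)%:R)).
  by move=> v v0; apply: r_inj => y; rewrite linear_expand v0.
exists (\sum_x \sum_y `|M' y x|); split.
  by apply: sumr_ge0 => x _; apply: sumr_ge0 => y _.
move=> v e e0 re x; rewrite {1}M'P (bigD1 x) //= mulrDl ler_wpDr //.
  by rewrite mulr_ge0 //; apply: sumr_ge0 => *; apply: sumr_ge0.
rewrite mulr_suml; apply: le_trans (ler_norm_sum _ _ _) _; apply: ler_sum => y _.
by rewrite normrM mulrC ler_wpM2l // -linear_expand.
Qed.
End LinearBound.

Section Factorials.
Variable n : nat.
Implicit Types a : mindex n.

Definition mfact a := (\prod_j (a j)`!)%N.

Lemma mfact_maddu a j : mfact (maddu a j) = ((a j).+1 * mfact a)%N.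
Proof.
rewrite /mfact (bigD1 j) //= [in RHS](bigD1 j) //= ffunE eqxx addn1 factS mulnA.
by congr (_ * _)%N; apply: eq_bigr => i /negPf ij; rewrite ffunE ij addn0.
Qed.

Lemma mfact_gt0 a : (0 < mfact a)%N.
Proof. by apply: prodn_gt0 => j; apply: fact_gt0. Qed.

(** A multinomial coefficient counts words over [n] letters. The induction writes |a|! as the sum
    over j of a_j (|a| - 1)! and bounds each of the [n] terms. *)
Lemma multinomial_bound a : ((mdeg a)`! <= n ^ mdeg a * mfact a)%N.
Proof.
have [m] := ubnP (mdeg a); elim: m a => // m IH a; rewrite ltnS => am.
case E : (mdeg a) => [|d]; first by rewrite mul1n mfact_gt0.
rewrite factS -E {1}/mdeg big_distrl /= E expnSr -mulnA mulnCA.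
rewrite -[n in (n * _)%N]card_ord -sum1_card big_distrl /=.
apply: leq_sum => j _; rewrite mul1n.
have [->|aj] := posnP (a j); first by [].
have aE : a = maddu (msubu a j) j.
  by apply/ffunP => i; rewrite !ffunE subnK //; case: eqP => // ->.
have degE : d = mdeg (msubu a j) by move: E; rewrite {1}aE mdeg_maddu => -[].
have -> : mfact a = (a j * mfact (msubu a j))%N.
  by rewrite {1}aE mfact_maddu ffunE eqxx subn1 prednK.
by rewrite degE mulnCA leq_mul2l IH ?orbT // -degE -ltnS -E.
Qed.
End Factorials.

Section Growth.
Variables (R : realType) (n : nat).
Local Notation C := R[i].
Implicit Types (f : pseries R n) (a : mindex n).

Definition taylor f : mindex n -> C := fun a => (mfact a)%:R * f a.

Lemma taylor_dpart f j a : taylor (dpart j f) a = taylor f (maddu a j).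
Proof. by rewrite /taylor /dpart mfact_maddu natrM; ring. Qed.

Lemma taylor_dpow f u a : taylor (dpow u f) a = taylor f (madd a u).
Proof.
have iterE j d g b : taylor (iter d (dpart j) g) b = taylor g (iter d (fun b' => maddu b' j) b).
  by elim: d b => // d IH b; rewrite iterS taylor_dpart IH -iterSr.
rewrite /dpow.
have foldE (s : seq 'I_n) b : uniq s ->
  taylor (foldr (fun j g => iter (u j) (dpart j) g) f s) b =
  taylor f [ffun i => (b i + (i \in s) * u i)%N].
  elim: s b => [|j s IH] b /=; first by move=> _; congr taylor; apply/ffunP => i; rewrite ffunE addn0.
  case/andP => js us; rewrite iterE IH //; congr taylor; apply/ffunP => i.
  have iter_maddu d : iter d (fun b' => maddu b' j) b i = (b i + (i == j) * d)%N.
    by elim: d => [|d IHd] /=; rewrite ?muln0 ?addn0 // ffunE IHd; case: (i == j); lia.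
  rewrite !ffunE iter_maddu inE; have [->|ij] := eqVneq i j; rewrite ?(negPf js) /=; lia.
rewrite foldE ?enum_uniq //; congr taylor.
by apply/ffunP => i; rewrite !ffunE mem_enum mul1n.
Qed.

Lemma growth_convergent f Q L : 0 <= Q -> 0 < L ->
  (forall a, `|taylor f a| <= Q * (L ^+ mdeg a * (mdeg a)`!%:R)) -> convergent f.
Proof.
(* Without variables there is a single coefficient, and the radius 1/(n L) used otherwise would
   degenerate. *)
move=> Q0 L0 fQ; case: (posnP n) => [n0|n_gt0].
  exists 1, `|f (mzero n)|; split=> // a; rewrite expr1n mulr1.
  by rewrite (_ : a = mzero n) //; apply/ffunP => -[j jn]; exfalso; move: jn; rewrite n0.
have nL : 0 < n%:R * L by rewrite mulr_gt0 ?ltr0n.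
exists (n%:R * L)^-1, Q; split=> [|a]; first by rewrite invr_gt0.
rewrite exprVn ler_pdivrMr ?exprn_gt0 //.
have fa0 : 0 < (mfact a)%:R :> C by rewrite ltr0n mfact_gt0.
rewrite -(ler_pM2l fa0) -{1}[(mfact a)%:R](@ger0_norm C) ?ler0n // -normrM.
apply: le_trans (fQ a) _; rewrite [X in _ <= X]mulrCA ler_wpM2l // exprMn.
rewrite [X in _ <= X](_ : _ = ((n ^ mdeg a * mfact a)%:R * L ^+ mdeg a)); last first.
  by rewrite natrM natrX; ring.
by rewrite mulrC ler_pM2r ?exprn_gt0 // ler_nat multinomial_bound.
Qed.
End Growth.

(** * The transposed binomial operators *)

Section Horn.
Variables (F : fieldType) (n k : nat) (e1 e2 m1 m2 : 'I_n -> F) (A : 'I_k -> 'I_n -> F).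
Hypotheses (m1e1 : \sum_j m1 j * e1 j = 1) (m1e2 : \sum_j m1 j * e2 j = 0)
  (m2e1 : \sum_j m2 j * e1 j = 0) (m2e2 : \sum_j m2 j * e2 j = 1)
  (A_ker : forall w : 'I_n -> F, \sum_j w j * e1 j = 0 -> \sum_j w j * e2 j = 0 ->
     exists y, forall j, w j = \sum_i y i * A i j)
  (Ae1 : forall i, \sum_j A i j * e1 j = 0) (Ae2 : forall i, \sum_j A i j * e2 j = 0).
Variable p : 'I_n -> F.
Hypothesis p_neq0 : forall j, p j != 0.
Local Notation K := {poly {poly F}}.
Local Notation cst c := (c%:P%:P : K).
Local Notation ffn eps := (ff e1 e2 eps).
Local Notation mpow := (mpow p).
Implicit Types (a u v : mindex n) (c : 'I_n -> F).

Section Operator.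
Variable eps : F.

(* The pair [g] is a shift vector with [e1 j * g.1 + e2 j * g.2 = u j - v j]: the
   operator is the transpose of [dpow u - dpow v] acting on linear forms on [K]. *)
Definition horn c u v (g : F * F) (q : K) : K :=
  cst (mpow u)^-1 * ffn eps c u * shift (eps * g.1) (eps * g.2) q
  - cst (mpow v)^-1 * ffn eps c v * q.

Definition horn_symb u v : {poly F} :=
  (mpow u)^-1%:P * \prod_j ell_symb e1 e2 j ^+ u j
  - (mpow v)^-1%:P * \prod_j ell_symb e1 e2 j ^+ v j.

Definition shift_vector u v (g : F * F) :=
  forall j, e1 j * g.1 + e2 j * g.2 = (u j)%:R - (v j)%:R.

Lemma horn_linear c u v g : op_linear (horn c u v g).
Proof. by move=> d q q'; rewrite /horn shift_linear; ring. Qed.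

Lemma horn_symbP c u v g d m q r : mdeg u = d -> mdeg v = d -> symb m q r ->
  symb (m + d) (horn c u v g q) (horn_symb u v * r).
Proof.
move=> ud vd qr; rewrite addnC /horn /horn_symb mulrBl.
apply: symbB; apply: symbM; [|exact: shift_symb| |by []].
  by rewrite -ud; apply/symbZ/ff_symb.
by rewrite -vd; apply/symbZ/ff_symb.
Qed.

(** The purpose of the translation in [horn]: it turns parameters lowered by [v] into parameters
    lowered by [u], so both terms of [horn] can absorb the same argument through [ff_madd]. *)
Lemma shift_cshift u v g c w : shift_vector u v g ->
  shift (eps * g.1) (eps * g.2) (ffn eps (cshift eps c v) w) = ffn eps (cshift eps c u) w.
Proof.
move=> gP; rewrite shift_ff /ff; apply: eq_bigr => j _; apply: eq_bigr => i _.
congr (_%:P%:P + _); rewrite /cshift mulrCA [e2 j * _]mulrCA -mulrDr gP; ring.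
Qed.

(** Each inner parameter is lowered by the [v] of the outer operator, and [shift_cshift] replaces
    that [v] by [u] in the translated term. The four resulting products then agree because
    [ff c (madd u v)] factors in either order. *)
Lemma horn_comm c u1 v1 g1 u2 v2 g2 q : shift_vector u1 v1 g1 -> shift_vector u2 v2 g2 ->
  horn c u1 v1 g1 (horn (cshift eps c v1) u2 v2 g2 q) =
  horn c u2 v2 g2 (horn (cshift eps c v2) u1 v1 g1 q).
Proof.
move=> gP1 gP2; rewrite /horn.
have E u v : ffn eps c u * ffn eps (cshift eps c u) v = ffn eps c v * ffn eps (cshift eps c v) u.
  by rewrite -!ff_madd maddC.
rewrite !(op_linearB _ _ (shift_linear _ _)) -!mulrA.
rewrite !(op_linearZ _ _ (shift_linear _ _)).
rewrite !(rmorphM (shift _ _)) /= !(shift_cshift _ _ gP1) !(shift_cshift _ _ gP2).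
rewrite (shiftC (eps * g1.1)).
set q12 := shift _ _ (shift _ _ q); set q1 := shift _ _ q; set q2 := shift _ _ q.
have := E u1 u2; have := E u1 v2; have := E v1 u2; have := E v1 v2.
set x := ffn eps c u1; set y := ffn eps c u2; set z := ffn eps c v1; set t := ffn eps c v2.
move=> E1 E2 E3 E4.
rewrite !mulrBr.
have L (s s' r r' f f' Q : K) : f * f' = r * r' -> s * (f * (s' * (f' * Q))) = s' * (r * (s * (r' * Q))).
  by move=> EE; rewrite [LHS](_ : _ = s * s' * Q * (f * f')); [rewrite EE; ring|ring].
rewrite (L _ _ _ _ _ _ _ E4) (L _ _ _ _ _ _ _ E3) (L _ _ _ _ _ _ _ E2) (L _ _ _ _ _ _ _ E1).
by ring.
Qed.

Lemma horn_ff c u v g a : shift_vector u v g ->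
  horn c u v g (ffn eps (cshift eps c v) a) =
  cst (mpow u)^-1 * ffn eps c (madd u a) - cst (mpow v)^-1 * ffn eps c (madd v a).
Proof. by move=> gP; rewrite /horn (shift_cshift _ _ gP) -!mulrA -!ff_madd. Qed.

(** By [ff_span] it suffices to test the image of [horn] on the products with parameter
    [cshift eps c v], where [horn_ff] gives its value. *)
Lemma horn_kernelP c u v g (gam : K -> F) : form_linear gam -> shift_vector u v g ->
  (forall q, gam (horn c u v g q) = 0) <->
  (forall a, (mpow u)^-1 * gam (ffn eps c (madd u a)) = (mpow v)^-1 * gam (ffn eps c (madd v a))).
Proof.
move=> gaml gP.
have gamE a : gam (horn c u v g (ffn eps (cshift eps c v) a)) =
    (mpow u)^-1 * gam (ffn eps c (madd u a)) - (mpow v)^-1 * gam (ffn eps c (madd v a)).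
  by rewrite horn_ff // (form_linearB _ _ gaml) !(form_linearZ _ _ gaml).
split=> [gam0 a|gam0 q]; first by apply/eqP; rewrite -subr_eq0 -gamE gam0.
apply: (ff_span m1e1 m1e2 m2e1 m2e2 (g := fun q => gam (horn c u v g q)) (eps := eps)
  (c := cshift eps c v)) => [d q1 q2|a]; first by rewrite horn_linear gaml.
by rewrite gamE gam0 subrr.
Qed.
End Operator.

(* For [eps = 1] these are the relations satisfied by the Taylor coefficients at
   [p] of a solution; for [eps = 0] and [c = 0], those of its principal symbols. *)
Definition hyper_system (I : Type) (u v : I -> mindex n) eps c (G : mindex n -> F) :=
  (forall i a, G (madd a (u i)) = G (madd a (v i))) /\
  (forall i a, \sum_j A i j * (p j * G (maddu a j) + eps * (a j)%:R * G a) =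
     (\sum_j A i j * c j) * G a).

Variables (I : Type) (u v : I -> mindex n) (g : I -> F * F).
Hypothesis gP : forall i, shift_vector (u i) (v i) (g i).

(** Multiplying by p^a removes [p] from the Euler relations, which become [euler]; evaluation of
    polynomials in the commuting operators supplies the form. *)
Lemma hyper_system_form eps c G : hyper_system u v eps c G ->
  exists gam, [/\ form_linear gam, forall i q, gam (horn eps c (u i) (v i) (g i) q) = 0
    & forall a, G a = (mpow a)^-1 * gam (ffn eps c a)].
Proof.
move=> [Guv Geuler]; pose phi a := mpow a * G a.
have phiE : euler A eps c phi.
  move=> i a; have := Geuler i a => /eqP; rewrite mulr_suml -subr_eq0 -sumrB => /eqP E.
  rewrite -[RHS](mulr0 (mpow a)) -[X in _ = _ * X]E mulr_sumr; apply: eq_bigr => j _.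
  by rewrite /eta /phi mpow_maddu; ring.
have gamE a := eval_form_ff m1e1 m1e2 m2e1 m2e2 A_ker a phiE.
have gaml := eval_form_linear m1 m2 eps c phi.
exists (eval_form m1 m2 eps c phi); split=> // [i|a].
  apply/(horn_kernelP eps c gaml (gP i)) => a; rewrite !gamE /phi !mpow_madd.
  rewrite (maddC (u i)) (maddC (v i)) Guv.
  by field; rewrite !mpow_neq0.
by rewrite gamE /phi mulKf // mpow_neq0.
Qed.

Lemma form_hyper_system eps c gam : form_linear gam ->
  (forall i q, gam (horn eps c (u i) (v i) (g i) q) = 0) ->
  hyper_system u v eps c (fun a => (mpow a)^-1 * gam (ffn eps c a)).
Proof.
move=> gaml gam0; split=> i a.
  have /(horn_kernelP eps c gaml (gP i))/(_ a) E := gam0 i.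
  by rewrite !(maddC a) !mpow_madd !invfM mulrAC E mulrAC.
have E j : p j * ((mpow (maddu a j))^-1 * gam (ffn eps c (maddu a j))) +
    eps * (a j)%:R * ((mpow a)^-1 * gam (ffn eps c a)) =
    (mpow a)^-1 * (c j * gam (ffn eps c a) + gam (ell e1 e2 j * ffn eps c a)).
  rewrite mpow_maddu ff_maddu mulrDl (form_linearD _ _ gaml) (form_linearZ _ _ gaml).
  by field; rewrite mpow_neq0 // p_neq0.
under eq_bigr => j _ do rewrite E mulrCA mulrDr mulrA.
rewrite -mulr_sumr big_split /= -mulr_suml mulrDr [in LHS]mulrCA addrC.
suff -> : \sum_j A i j * gam (ell e1 e2 j * ffn eps c a) = 0 by rewrite mulr0 add0r.
rewrite -(form_linear_sum _ _ _ gaml).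
rewrite (_ : \sum_j _ = 0) ?form_linear0 //.
have comb (e : 'I_n -> F) (q : K) :
    \sum_j cst (A i j) * (cst (e j) * q) = cst (\sum_j A i j * e j) * q.
  by rewrite !rmorph_sum mulr_suml; apply: eq_bigr => j _; rewrite mulrA -!polyCM.
under eq_bigr => j _ do rewrite /ell mulrDl -!mulrA mulrDr.
by rewrite big_split /= !comb Ae1 Ae2 !mul0r addr0.
Qed.
End Horn.

(** * Dimension of the solution space *)

Lemma ord2P (P : 'I_2 -> Prop) : P ord0 -> P ord_max -> forall i, P i.
Proof.
by move=> P0 P1 [[|[|//]] i_lt];
  [rewrite (_ : Ordinal _ = ord0) //|rewrite (_ : Ordinal _ = ord_max) //]; apply: val_inj.
Qed.

Section Dimension.
Variables (F : fieldType) (n k : nat) (e1 e2 m1 m2 : 'I_n -> F) (A : 'I_k -> 'I_n -> F).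
Hypotheses (m1e1 : \sum_j m1 j * e1 j = 1) (m1e2 : \sum_j m1 j * e2 j = 0)
  (m2e1 : \sum_j m2 j * e1 j = 0) (m2e2 : \sum_j m2 j * e2 j = 1)
  (A_ker : forall w : 'I_n -> F, \sum_j w j * e1 j = 0 -> \sum_j w j * e2 j = 0 ->
     exists y, forall j, w j = \sum_i y i * A i j)
  (Ae1 : forall i, \sum_j A i j * e1 j = 0) (Ae2 : forall i, \sum_j A i j * e2 j = 0).
Variable p : 'I_n -> F.
Hypothesis p_neq0 : forall j, p j != 0.
Variables (u v : 'I_2 -> mindex n) (g : 'I_2 -> F * F) (a b : nat).
Local Notation h1 := (horn_symb e1 e2 p (u ord0) (v ord0)).
Local Notation h2 := (horn_symb e1 e2 p (u ord_max) (v ord_max)).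
Hypotheses (gP : forall i, shift_vector e1 e2 (u i) (v i) (g i))
  (u1_deg : mdeg (u ord0) = a.+1) (v1_deg : mdeg (v ord0) = a.+1)
  (u2_deg : mdeg (u ord_max) = b.+1) (v2_deg : mdeg (v ord_max) = b.+1)
  (h_coprime : coprimep h1 h2) (size_h1 : size h1 = a.+2) (size_h2 : size h2 = b.+2).
Local Notation hyper_system := (hyper_system A p u v).

Theorem hyper_system_basis eps c : exists G : 'I_(a.+1 * b.+1) -> mindex n -> F,
  [/\ forall l, hyper_system eps c (G l),
      forall lam, (forall x, \sum_l lam l * G l x = 0) -> forall l, lam l = 0
    & forall f, hyper_system eps c f -> exists lam, forall x, f x = \sum_l lam l * G l x].
Proof.
have [Gam [GamP Gam_free Gam_span]] := annihilator_basis h_coprime size_h1 size_h2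
  (horn_linear e1 e2 p eps c (u ord0) (v ord0) (g ord0))
  (horn_linear e1 e2 p eps c (u ord_max) (v ord_max) (g ord_max))
  (horn_linear e1 e2 p eps (cshift eps c (v ord_max)) (u ord0) (v ord0) (g ord0))
  (horn_linear e1 e2 p eps (cshift eps c (v ord0)) (u ord_max) (v ord_max) (g ord_max))
  (fun m q r => horn_symbP (m:=m) (q:=q) (r:=r) e1 e2 p eps c (g ord0) u1_deg v1_deg)
  (fun m q r => horn_symbP (m:=m) (q:=q) (r:=r) e1 e2 p eps c (g ord_max) u2_deg v2_deg)
  (fun m q r => horn_symbP (m:=m) (q:=q) (r:=r) e1 e2 p eps _ (g ord0) u1_deg v1_deg)
  (fun m q r => horn_symbP (m:=m) (q:=q) (r:=r) e1 e2 p eps _ (g ord_max) u2_deg v2_deg)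
  (fun q => horn_comm p eps c q (gP ord0) (gP ord_max)).
exists (fun l x => (mpow p x)^-1 * Gam l (ff e1 e2 eps c x)); split.
- move=> l; have [Gaml Gam1 Gam2] := GamP l.
  apply: (form_hyper_system m1e1 m1e2 m2e1 m2e2 Ae1 Ae2 p_neq0 gP Gaml).
  by apply: (@ord2P (fun i => forall q, Gam l (horn e1 e2 p eps c (u i) (v i) (g i) q) = 0)).
- move=> lam lam0; apply: Gam_free.
  apply: (ff_span m1e1 m1e2 m2e1 m2e2 (eps := eps) (c := c)) => [d q q'|x].
    rewrite mulr_sumr -big_split /=; apply: eq_bigr => l _.
    by have [-> _ _] := GamP l; ring.
  have /(congr1 ( *%R (mpow p x))) := lam0 x; rewrite mulr0 mulr_sumr => E.
  by rewrite -[RHS]E; apply: eq_bigr => l _; rewrite mulrCA mulVKf // mpow_neq0.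
- move=> f /(hyper_system_form m1e1 m1e2 m2e1 m2e2 A_ker p_neq0 gP)[gam [gaml gam0 fE]].
  have [lam lamE] := Gam_span gam gaml (gam0 ord0) (gam0 ord_max).
  exists lam => x; rewrite fE lamE mulr_sumr.
  by apply: eq_bigr => l _; rewrite mulrCA.
Qed.

Lemma hmg_ff0 x :
  hmg (ff e1 e2 0 (fun=> 0) x) = (\prod_j ell_symb e1 e2 j ^+ x j)%:P * 'X^(mdeg x).
Proof.
have hmg_ell j : hmg (ell e1 e2 j) = (ell_symb e1 e2 j)%:P * 'X.
  rewrite hmgD !hmgM !hmg_cst hmg_s hmg_poly map_polyX.
  by rewrite /ell_symb polyCD polyCM; ring.
rewrite /ff (rmorph_prod (@hmg F)) /mdeg -prodrXr rmorph_prod -big_split /=.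
apply: eq_bigr => j _; elim: (x j) => [|d IH].
  by rewrite big_ord0 !expr0 mulr1; exact: rmorph1.
rewrite big_ord_recr /= hmgM IH mul0r subr0 !polyC0 add0r hmg_ell !exprSr polyCM.
by ring.
Qed.

(** For [eps = 0] and [c = 0] the translations vanish and the operators are multiplications by
    homogeneous forms. A product of degree above [a + b] then lies in their ideal with no remainder
    of lower degree. *)
Lemma hyper_system_graded G : hyper_system 0 (fun=> 0) G ->
  forall x, (a + b < mdeg x)%N -> G x = 0.
Proof.
move/(hyper_system_form m1e1 m1e2 m2e1 m2e2 A_ker p_neq0 gP) => [gam [gaml gam0 GE]] x abx.
have size_x : (size (\prod_j ell_symb e1 e2 j ^+ x j)%R <= (mdeg x).+1)%N.
  by have [_ <-] := ff_symb e1 e2 0 (fun=> 0) x; exact: size_coef_hmg.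
have [r1 [r2 [rE size_r1 size_r2]]] := coprimep_decompose h_coprime size_h1 size_h2 abx size_x.
have hornE i d (r : {poly F}) : mdeg (u i) = d.+1 -> mdeg (v i) = d.+1 -> (d < mdeg x)%N ->
    (size r <= mdeg x - d)%N ->
    hmg (horn e1 e2 p 0 (fun=> 0) (u i) (v i) (g i) (lift (mdeg x - d.+1) r)) =
    (horn_symb e1 e2 p (u i) (v i) * r)%:P * 'X^(mdeg x).
  move=> ud vd dx size_r; rewrite /horn !mul0r shift00 hmgD hmgN !hmgM !hmg_cst.
  rewrite hmg_lift; last by apply: leq_trans size_r _; lia.
  rewrite !hmg_ff0 ud vd -{3}(subnKC dx) exprD /horn_symb.
  by rewrite !(polyCM, polyCB); ring.
rewrite GE (_ : ff _ _ _ _ _ =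
    horn e1 e2 p 0 (fun=> 0) (u ord0) (v ord0) (g ord0) (lift (mdeg x - a.+1) r1) +
    horn e1 e2 p 0 (fun=> 0) (u ord_max) (v ord_max) (g ord_max) (lift (mdeg x - b.+1) r2)).
  by rewrite (form_linearD _ _ gaml) !gam0 addr0 mulr0.
apply: hmg_inj; rewrite hmgD !hornE // ?(leq_ltn_trans _ abx) ?leq_addr ?leq_addl //.
by rewrite hmg_ff0 rE -mulrDl -polyCD.
Qed.
End Dimension.

(** * Growth of Taylor coefficients *)

Lemma mindex_split n (a : mindex n) N : (N <= mdeg a)%N ->
  exists a' y : mindex n, a = madd a' y /\ mdeg y = N.
Proof.
elim: N => [|N IH] Na.
  by exists a, (mzero n); rewrite madd0; split=> //; apply: big1 => j _; rewrite ffunE.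
have [a' [y [aE yN]]] := IH (ltnW Na).
have : (0 < mdeg a')%N by move: Na; rewrite aE mdeg_madd yN; lia.
rewrite lt0n sum_nat_eq0 negb_forall => /existsP[j /= a'j].
exists (msubu a' j), (maddu y j); rewrite mdeg_maddu yN aE; split=> //.
apply/ffunP => i; rewrite !ffunE.
by case: eqP => [->|_]; [move: a'j; lia|lia].
Qed.

Section SolutionGrowth.
Variables (C : numFieldType) (n k : nat) (A : 'I_k -> 'I_n -> C) (p : 'I_n -> C).
Variables (u v : 'I_2 -> mindex n) (N : nat).
Hypothesis uv_deg : forall i, mdeg (u i) = mdeg (v i).
Hypothesis graded : forall G, hyper_system A p u v 0 (fun=> 0) G ->
  forall x, (N < mdeg x)%N -> G x = 0.
Implicit Types (a y : mindex n) (c : 'I_n -> C) (F : mindex n -> C).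

(** A finite type containing every multi-index of degree at most [N + 1], since no entry of such an
    index exceeds [N + 1]. *)
Local Notation box := {ffun 'I_n -> 'I_N.+2}.
Local Notation rels := (box + ('I_2 * box + 'I_k * box))%type.

Let unbox (x : box) : mindex n := [ffun j => x j : nat].
Let inbox a : box := [ffun j => inord (a j)].

Let inboxK a : (mdeg a <= N.+1)%N -> unbox (inbox a) = a.
Proof.
move=> aN; apply/ffunP => j; rewrite !ffunE inordK // ltnS (leq_trans _ aN) //.
by rewrite /mdeg (bigD1 j) //= leq_addr.
Qed.

Let unboxK x : inbox (unbox x) = x.
Proof. by apply/ffunP => j; rewrite !ffunE; apply/val_inj; rewrite /= inordK. Qed.

Let top_part (w : box -> C) a : C := if mdeg a == N.+1 then w (inbox a) else 0.

(** The homogeneous system in the single degree [N + 1], as finitely many functionals. Those indexed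
    by [inl] kill the coordinates outside this degree, so injectivity can hold on the whole
    space. *)
Let rel (r : rels) (w : box -> C) : C :=
  match r with
  | inl x => if mdeg (unbox x) == N.+1 then 0 else w x
  | inr (inl (i, x)) => top_part w (madd (unbox x) (u i)) - top_part w (madd (unbox x) (v i))
  | inr (inr (i, x)) => \sum_j A i j * (p j * top_part w (maddu (unbox x) j))
  end.

Let top_part_linear d w w' a :
  top_part (fun x => d * w x + w' x) a = d * top_part w a + top_part w' a.
Proof. by rewrite /top_part; case: ifP => _; ring. Qed.

Let rel_linear r d w w' : rel r (fun x => d * w x + w' x) = d * rel r w + rel r w'.
Proof.
case: r => [x|[[i x]|[i x]]] /=; first by case: ifP => _; ring.
  by rewrite !top_part_linear; ring.
rewrite mulr_sumr -big_split; apply: eq_bigr => j _ /=.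
by rewrite top_part_linear; ring.
Qed.

Let top_part_eq0 w a : (N.+1 < mdeg a)%N -> top_part w a = 0.
Proof. by rewrite /top_part => /gtn_eqF ->. Qed.

(** Extended by zero, [w] solves the full homogeneous system: relations based in degree at most
    [N + 1] are among [rel], and the others involve only zeros. Hence [graded] applies. *)
Let rel_injective w : (forall r, rel r w = 0) -> forall x, w x = 0.
Proof.
move=> w0 x; have [xN|xN] := eqVneq (mdeg (unbox x)) N.+1; last first.
  by have := w0 (inl x); rewrite /= (negPf xN).
have wE : w x = top_part w (unbox x) by rewrite /top_part xN eqxx unboxK.
rewrite wE; apply: graded; last by rewrite xN.
split=> i a; have [aN|aN] := leqP (mdeg a) N.+1.
- have /eqP := w0 (inr (inl (i, inbox a))).
  by rewrite /= inboxK // subr_eq0 => /eqP.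
- by rewrite !top_part_eq0 // mdeg_madd (leq_trans aN) ?leq_addr.
- have := w0 (inr (inr (i, inbox a))); rewrite /= inboxK // => E.
  rewrite (eq_bigr (fun j => A i j * (p j * top_part w (maddu a j)))) ?E => [|j _].
    by rewrite big1 ?mul0r // => j _; rewrite mulr0.
  by ring.
- rewrite !big1 ?mul0r // => j _; rewrite ?mulr0 // !top_part_eq0 ?mdeg_maddu ?(ltnW aN) //.
    by ring.
  exact: leqW.
Qed.

(** Write [a = a' + z] with [z] of degree [N + 1] and restrict [F] to the translates of [a'] by that
    degree. The binomial relations hold exactly; the homogeneous Euler relations hold up to terms in
    coefficients of order one less than [a]. Inverting [rel] gives the bound, with a constant
    independent of [a]. *)
Lemma hyper_system_step c : exists K, 0 <= K /\
  forall F, hyper_system A p u v 1 c F -> forall a M, 0 <= M -> (N < mdeg a)%N ->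
    (forall y, (mdeg y).+1 = mdeg a -> `|F y| <= M) -> `|F a| <= K * (mdeg a)%:R * M.
Proof.
have [K0 [K0_ge0 K0P]] := injective_bound rel_linear rel_injective.
(* The error terms carry the factors [c j] minus an entry of an index of degree |a| - 1; as |a| is
   positive, their norm is at most |a| times [|c j| + 1]. *)
pose S := \sum_i \sum_j `|A i j| * (`|c j| + 1).
have S_ge0 : 0 <= S.
  by apply: sumr_ge0 => i _; apply: sumr_ge0 => j _; rewrite mulr_ge0 ?addr_ge0.
exists (K0 * S); split=> [|F [Fuv Feuler] a M M0 Na FM]; first exact: mulr_ge0.
have [a' [z [aE zN]]] := mindex_split Na.
pose w (x : box) := if mdeg (unbox x) == N.+1 then F (madd a' (unbox x)) else 0.
have wE y : top_part w y = if mdeg y == N.+1 then F (madd a' y) else 0.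
  by rewrite /top_part /w; case: eqP => // yN; rewrite inboxK ?yN ?eqxx.
have -> : F a = w (inbox z) by rewrite /w inboxK ?zN ?eqxx ?aE.
have SM : 0 <= S * (mdeg a)%:R * M by rewrite !mulr_ge0.
rewrite [X in _ <= X](_ : _ = K0 * (S * (mdeg a)%:R * M)); last by ring.
apply: K0P => //.
case=> [x|[[i x]|[i x]]] /=.
- by rewrite /w; case: (mdeg (unbox x) == N.+1); rewrite normr0.
- rewrite !wE !mdeg_madd uv_deg; case: ifP => _; last by rewrite subrr normr0.
  have addA y : madd a' (madd (unbox x) y) = madd (madd a' (unbox x)) y.
    by apply/ffunP => j; rewrite !ffunE addnA.
  by rewrite !addA Fuv subrr normr0.
set y := unbox x; have [yN|yN] := eqVneq (mdeg y).+1 N.+1; last first.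
  rewrite big1 ?normr0 // => j _.
  by rewrite wE mdeg_maddu (negPf yN) !mulr0.
have degE : (mdeg (madd a' y)).+1 = mdeg a by rewrite aE !mdeg_madd zN -yN addnS.
have addE j : madd a' (maddu y j) = maddu (madd a' y) j.
  by apply/ffunP => l; rewrite !ffunE addnA.
have -> : \sum_j A i j * (p j * top_part w (maddu y j)) =
    \sum_j A i j * (c j - (madd a' y j)%:R) * F (madd a' y).
  have := Feuler i (madd a' y); rewrite mulr_suml => /eqP.
  rewrite -subr_eq0 -sumrB => /eqP E; apply/eqP; rewrite -subr_eq0 -sumrB; apply/eqP.
  by rewrite -[RHS]E; apply: eq_bigr => j _; rewrite wE mdeg_maddu yN eqxx addE; ring.
apply: le_trans (ler_norm_sum _ _ _) _.
apply: (@le_trans _ _ (\sum_j `|A i j| * (`|c j| + 1) * ((mdeg a)%:R * M))).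
  apply: ler_sum => j _; rewrite !normrM -!mulrA ler_wpM2l // mulrA.
  apply: ler_pM => //; last exact: FM.
  apply: le_trans (ler_normB _ _) _; rewrite mulrDl mul1r lerD //.
    by rewrite ler_peMr // ler1n; move: degE; case: (mdeg a).
  rewrite ger0_norm ?ler0n // ler_nat -degE (leq_trans _ (leqnSn _)) //.
  by rewrite [X in (_ <= X)%N](bigD1 j) //= leq_addr.
rewrite -mulr_suml -mulrA ler_wpM2r ?mulr_ge0 //.
rewrite /S (bigD1 i) //= ler_wpDr //; apply: sumr_ge0 => i' _; apply: sumr_ge0 => j _.
by rewrite mulr_ge0 ?addr_ge0.
Qed.

Lemma hyper_system_growth c F : hyper_system A p u v 1 c F ->
  exists Q L, [/\ 0 <= Q, 0 < L &
    forall a, `|F a| <= Q * (L ^+ mdeg a * (mdeg a)`!%:R)].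
Proof.
move=> FS; have [K [K0 KP]] := hyper_system_step c.
(* [Q] dominates every coefficient of order at most [N]; taking [K + 1] as the ratio keeps it at
   least 1, so the bound holds in those orders too. *)
pose Q := \sum_x `|F (unbox x)|.
have Q0 : 0 <= Q by apply: sumr_ge0.
have L0 : 0 < K + 1 by rewrite ltr_wpDl.
have L1 : 1 <= K + 1 by rewrite lerDr.
exists Q, (K + 1); split=> // a.
have [m] := ubnP (mdeg a); elim: m a => // m IH a; rewrite ltnS => am.
have [aN|aN] := leqP (mdeg a) N.
  apply: (@le_trans _ _ Q).
    by rewrite /Q (bigD1 (inbox a)) //= inboxK ?(leqW aN) // lerDl; apply: sumr_ge0.
  by rewrite ler_peMr // mulr_ege1 ?exprn_ege1 ?ler1n ?fact_gt0.
case aE : (mdeg a) => [|d]; first by rewrite aE in aN.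
apply: (le_trans (KP _ FS a (Q * ((K + 1) ^+ d * d`!%:R)) _ aN _)).
- by rewrite !mulr_ge0 // exprn_ge0 // ltW.
- move=> y; rewrite aE => -[yd]; have := IH y; rewrite yd; apply.
  by rewrite -ltnS -aE ltnS.
rewrite aE [X in _ <= X](_ : _ = (K + 1) * d.+1%:R * (Q * ((K + 1) ^+ d * d`!%:R))); last first.
  by rewrite exprS factS natrM; ring.
by rewrite !ler_wpM2r ?lerDl // !mulr_ge0 // exprn_ge0 // ltW.
Qed.
End SolutionGrowth.

(** * Solutions, exponents and torus points *)

Section SolutionsAsSystems.
Variables (R : realType) (n : nat) (A : 'M[int]_(n - 2, n)) (B : 'M[int]_(n, 2)).
Variables (c p : 'I_n -> R[i]).
Local Notation sys := (hyper_system (fun i j => (A i j)%:~R) p (colpos B) (colneg B) 1 c).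
Implicit Types (f : pseries R n).

Let mfact_neq0 (a : mindex n) : (mfact a)%:R != 0 :> R[i].
Proof. by rewrite pnatr_eq0 -lt0n mfact_gt0. Qed.

(** Multiplication by x_j splits as p_j plus x_j - p_j; the second part undoes the index shift of
    the derivative and leaves the factor a_j. *)
Lemma taylor_euler_term f j a : (mfact a)%:R * mulx p j (dpart j f) a =
  p j * taylor f (maddu a j) + (a j)%:R * taylor f a.
Proof.
rewrite /mulx mulrDr mulrCA; congr (_ * _ + _); first exact: taylor_dpart.
have [->|aj] := posnP (a j); first by rewrite mulr0 mul0r.
have aE : maddu (msubu a j) j = a.
  by apply/ffunP => i; rewrite !ffunE subnK //; case: eqP => // ->.
by rewrite /dpart aE ffunE eqxx subn1 prednK // /taylor; ring.
Qed.

Lemma taylor_euler_op f i a : (mfact a)%:R * euler_op A c p i f a =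
  \sum_j (A i j)%:~R * (p j * taylor f (maddu a j) + 1 * (a j)%:R * taylor f a)
  - (\sum_j (A i j)%:~R * c j) * taylor f a.
Proof.
rewrite /euler_op /sub_ps /sum_ps /scale_ps big_map big_enum mulrBr mulr_sumr.
congr (_ - _); last by rewrite mulrCA.
by apply: eq_bigr => j _; rewrite mulrCA taylor_euler_term mul1r.
Qed.

Lemma solution_hyper_system f : is_solution A B c p f <-> convergent f /\ sys (taylor f).
Proof.
have binomE i a : (mfact a)%:R * binom_op B i f a =
    taylor f (madd a (colpos B i)) - taylor f (madd a (colneg B i)).
  by rewrite -!taylor_dpow /taylor -mulrBr.
have mul_eq0 (a : mindex n) (x : R[i]) : (mfact a)%:R * x = 0 -> x = 0.
  by move/eqP; rewrite mulf_eq0 (negPf (mfact_neq0 a)) => /eqP.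
split=> [[f_conv f_binom f_euler]|[f_conv [f_binom f_euler]]]; split=> //.
- split=> i a; apply/eqP; rewrite -subr_eq0; first by rewrite -binomE f_binom mulr0.
  by rewrite -taylor_euler_op f_euler mulr0.
- by move=> i a; apply: (mul_eq0 a); rewrite binomE f_binom subrr.
- by move=> i a; apply: (mul_eq0 a); rewrite taylor_euler_op f_euler subrr.
Qed.
End SolutionsAsSystems.

Section Exponents.
Variables (n : nat) (B : 'M[int]_(n, 2)).

Lemma col_diff (S : nzRingType) i j :
  (colpos B i j)%:R - (colneg B i j)%:R = (B j i)%:~R :> S.
Proof.
rewrite !ffunE; case: (B j i) => d /=; first by rewrite subr0.
by rewrite sub0r NegzE mulrNz.
Qed.

Lemma colpos_gt0 i j : (0 < colpos B i j)%N -> 0 < B j i.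
Proof. by rewrite ffunE; case: (B j i). Qed.

Lemma colneg_gt0 i j : (0 < colneg B i j)%N -> B j i < 0.
Proof. by rewrite ffunE; case: (B j i). Qed.

Lemma mdeg_colpos i : mdeg (colpos B i) = degB B i.
Proof.
rewrite /degB big_mkcond; apply: eq_bigr => j _; rewrite ffunE.
by case: (B j i) => [[|d]|d].
Qed.

Lemma mdeg_colneg i : \sum_j B j i = 0 -> mdeg (colneg B i) = mdeg (colpos B i).
Proof.
move=> B0; have : (mdeg (colpos B i))%:R - (mdeg (colneg B i))%:R = 0 :> int.
  rewrite /mdeg !natr_sum -sumrB -[RHS]B0; apply: eq_bigr => j _.
  by rewrite col_diff intz.
by move/eqP; rewrite subr_eq0 => /eqP; rewrite !natz => -[].
Qed.

Variables (C : fieldType) (p : 'I_n -> C).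
Hypothesis p_neq0 : forall j, p j != 0.

Lemma mpow_colpos i : mpow p (colpos B i) = (\prod_j p j ^ B j i) * mpow p (colneg B i).
Proof.
rewrite /mpow -big_split; apply: eq_bigr => j _ /=; rewrite !ffunE.
case: (B j i) => d /=; first by rewrite mulr1.
by rewrite NegzE -exprnN mulVf // expf_neq0.
Qed.
End Exponents.

Lemma prod_exprz (C : fieldType) (I : finType) (x : C) (m : I -> int) : x != 0 ->
  \prod_i x ^ m i = x ^ (\sum_i m i).
Proof.
move=> x0; elim/big_rec2: _ => [|i y z _ ->]; first by rewrite expr0z.
by rewrite expfzDr.
Qed.

Lemma size_prod_linear (C : fieldType) (I : finType) (L : I -> {poly C}) (u : I -> nat) :
  (forall i, (0 < u i)%N -> size (L i) = 2) ->
  size (\prod_i L i ^+ u i) = (\sum_i u i).+1.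
Proof.
move=> sL; have sX i : size (L i ^+ u i) = (u i).+1.
  have [->|ui] := posnP (u i); first by rewrite expr0 size_poly1.
  have L0 : L i != 0 by rewrite -size_poly_gt0 sL.
  have := size_exp (L i) (u i); rewrite sL // mul1n => sE.
  by rewrite -[in RHS]sE prednK // size_poly_gt0 expf_neq0.
elim/big_rec2: _ => [|i d P _ sP]; first by rewrite size_poly1.
by rewrite size_mul -?size_poly_gt0 ?sX ?sP // addSn addnS.
Qed.

Lemma root_prod_exp (C : fieldType) (I : finType) (L : I -> {poly C}) (u : I -> nat) r :
  root (\prod_i L i ^+ u i) r -> exists2 i, (0 < u i)%N & root (L i) r.
Proof.
rewrite /root horner_prod => /prodf_eq0[i _]; rewrite horner_exp expf_eq0 => /andP[].
by exists i.
Qed.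

Section Rank.
Variables (C : numFieldType) (n : nat) (B : 'M[int]_(n, 2)) (A : 'M[int]_(n - 2, n)).
Hypotheses (rankB : \rank (map_mx (intr : int -> rat) B) = 2%N)
  (rankA : \rank (map_mx (intr : int -> rat) A) = (n - 2)%N)
  (AB0 : A *m B = 0).

Let rank_intr m m' (M : 'M[int]_(m, m')) :
  \rank (map_mx (intr : int -> C) M) = \rank (map_mx (intr : int -> rat) M).
Proof.
rewrite -[RHS](mxrank_map (ratr : {rmorphism rat -> C})); congr (\rank _).
by apply/matrixP => i j; rewrite !mxE; exact/esym/ratr_int.
Qed.

Lemma exponent_left_inverse : exists M : 'I_2 -> 'I_n -> C,
  forall i l, \sum_j M i j * (B j l)%:~R = (i == l)%:R.
Proof.
have /row_fullP[M MB] : row_full (map_mx (intr : int -> C) B).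
  by rewrite /row_full rank_intr rankB.
exists (fun i j => M i j) => i l; have /matrixP/(_ i l) := MB.
by rewrite !mxE => <-; apply: eq_bigr => j _; rewrite mxE.
Qed.

(** The row space of [A] lies in the left kernel of [B], and both have dimension [n - 2]. *)
Lemma relation_kernel (w : 'I_n -> C) : (forall l, \sum_j w j * (B j l)%:~R = 0) ->
  exists y : 'I_(n - 2) -> C, forall j, w j = \sum_i y i * (A i j)%:~R.
Proof.
move=> wB; set BC := map_mx (intr : int -> C) B; set AC := map_mx (intr : int -> C) A.
have A_ker : (AC <= kermx BC)%MS.
  by apply/sub_kermxP; rewrite -map_mxM AB0 map_mx0.
have /eqP/esym rankE : \rank AC = \rank (kermx BC).
  by rewrite mxrank_ker !rank_intr rankA rankB.
have [_] := mxrank_leqif_sup A_ker; rewrite -rankE => /esym ker_A.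
have : (\row_j w j <= AC)%MS.
  apply: submx_trans ker_A; apply/sub_kermxP/rowP => l.
  by rewrite !mxE -[RHS](wB l); apply: eq_bigr => j _; rewrite !mxE.
case/submxP => y wE; exists (y 0) => j; have /rowP/(_ j) := wE.
by rewrite !mxE => ->; apply: eq_bigr => i _; rewrite mxE.
Qed.

(** Were all 2 by 2 minors zero, the identity matrix, as a left inverse times [B], would have
    determinant 0. *)
Lemma nonzero_minor : exists j l, B j ord0 * B l ord_max - B j ord_max * B l ord0 != 0.
Proof.
have [M MB] := exponent_left_inverse.
have [/existsP[j /existsP[l jl]]|] :=
  boolP [exists j, exists l, B j ord0 * B l ord_max - B j ord_max * B l ord0 != 0].
  by exists j, l.
rewrite negb_exists => /forallP minor0.
have minorE j l : (B j ord0)%:~R * (B l ord_max)%:~R = (B j ord_max)%:~R * (B l ord0)%:~R :> C.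
  have := minor0 j; rewrite negb_exists => /forallP/(_ l); rewrite negbK subr_eq0 => /eqP E.
  by rewrite -!intrM E.
have mulE (f h f' h' : 'I_n -> C) : (\sum_j f j * h j) * (\sum_l f' l * h' l) =
    \sum_j \sum_l f j * f' l * (h j * h' l).
  rewrite mulr_suml; apply: eq_bigr => j _; rewrite mulr_sumr.
  by apply: eq_bigr => l _; ring.
have : (\sum_j M ord0 j * (B j ord0)%:~R) * (\sum_l M ord_max l * (B l ord_max)%:~R) =
    (\sum_j M ord0 j * (B j ord_max)%:~R) * (\sum_l M ord_max l * (B l ord0)%:~R).
  by rewrite !mulE; apply: eq_bigr => j _; apply: eq_bigr => l _; rewrite minorE.
by rewrite !MB /= mulr1 mul0r => /eqP; rewrite oner_eq0.
Qed.

(** Cramer's rule on a nonzero minor [D]: integer vectors [m] and [m'] with products (D, 0) and (0,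
    D) against [B] give one-parameter subgroups of the torus that move the two ratios separately.
    Hence the values (k + 1)^D. *)
Lemma torus_points : exists z : nat -> C, injective z /\
  forall k l, exists p, [/\ forall j, p j != 0,
    mpow p (colpos B ord0) = z k * mpow p (colneg B ord0) &
    mpow p (colpos B ord_max) = z l * mpow p (colneg B ord_max)].
Proof.
have [j [l D0]] := nonzero_minor; set D := (X in X != 0) in D0.
exists (fun k => (k.+1)%:R ^ D); split.
  have pow_inj d (k k' : nat) : (0 < d)%N -> k.+1%:R ^+ d = k'.+1%:R ^+ d :> C -> k = k'.
    by move=> d0 /eqP; rewrite eqrXn2 ?ler0n // eqr_nat eqSS => /eqP.
  move=> k k'; move: D0; case: (D) => d; first by rewrite -lt0n => /pow_inj; apply.
  by rewrite NegzE -!exprnN => _ /invr_inj; apply: pow_inj.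
move=> k k'; pose m (i : 'I_n) := (i == j)%:R * B l ord_max - (i == l)%:R * B j ord_max.
pose m' (i : 'I_n) := (i == l)%:R * B j ord0 - (i == j)%:R * B l ord0.
have delta i0 (h : 'I_n -> int) : \sum_i (i == i0)%:R * h i = h i0.
  by rewrite (bigD1 i0) //= eqxx mul1r big1 ?addr0 // => i /negPf ->; rewrite mul0r.
have mE i0 i1 (x y : int) (h : 'I_n -> int) :
    \sum_i ((i == i0)%:R * x - (i == i1)%:R * y) * h i = x * h i0 - y * h i1.
  by rewrite -(delta i0 h) -(delta i1 h) !mulr_sumr -sumrB; apply: eq_bigr => i _; ring.
have k0 d : d.+1%:R != 0 :> C by rewrite pnatr_eq0.
pose p (i : 'I_n) : C := k.+1%:R ^ m i * k'.+1%:R ^ m' i.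
have p0 i : p i != 0 by rewrite mulf_neq0 // expfz_neq0.
have pE o : \prod_i p i ^ B i o =
    k.+1%:R ^ (\sum_i m i * B i o) * k'.+1%:R ^ (\sum_i m' i * B i o).
  rewrite -!prod_exprz // -big_split; apply: eq_bigr => i _ /=.
  by rewrite exprzMl ?unitfE ?expfz_neq0 // !exprz_exp.
exists p; split=> //; rewrite mpow_colpos // pE !mE; congr (_ * _).
  rewrite [X in _ ^ X * _](_ : _ = D) ?[X in _ * _ ^ X](_ : _ = 0) ?expr0z ?mulr1 //.
  - by ring.
  - by rewrite /D; ring.
rewrite [X in _ ^ X * _](_ : _ = 0) ?[X in _ * _ ^ X](_ : _ = D) ?expr0z ?mul1r //.
- by rewrite /D; ring.
- by ring.
Qed.
End Rank.

(** * Opposite quadrants and the rank *)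

(* The vector [(kappa, 1)] is orthogonal to no nonzero row of [B]: dehomogenizing along
   it, no linear form [ell j] with [b_j != 0] loses its leading coefficient. *)
Lemma transversal_direction n (B : 'M[int]_(n, 2)) : exists kappa : nat,
  forall j, B j ord0 *+ kappa + B j ord_max = 0 -> B j ord0 = 0 /\ B j ord_max = 0.
Proof.
exists (\sum_j absz (B j ord_max)).+1 => j E.
suff B0 : B j ord0 = 0 by move: E; rewrite B0 mul0rn add0r.
apply: contra_eq E => B0.
have : (absz (B j ord_max) <= \sum_j absz (B j ord_max))%N.
  by rewrite [X in (_ <= X)%N](bigD1 j) //= leq_addr.
by move: (\sum_j _)%N => s; rewrite -mulr_natr natz; nia.
Qed.

Section Quadrants.
Variables (C : numFieldType) (n : nat) (B : 'M[int]_(n, 2)) (kappa : nat).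
Hypothesis no_opposite : forall j k : 'I_n,
  ~ [/\ B j ord0 * B k ord_max - B j ord_max * B k ord0 = 0,
        B j ord0 * B k ord0 < 0 & B j ord_max * B k ord_max < 0].
Hypothesis kappaP : forall j, B j ord0 *+ kappa + B j ord_max = 0 ->
  B j ord0 = 0 /\ B j ord_max = 0.
(** In these coordinates [ell_symb e1 e2 j] at x is the pairing of the j-th row with the vector
    (kappa x + 1, x). *)
Local Notation e1 := (fun j => (B j ord0 *+ kappa + B j ord_max)%:~R : C).
Local Notation e2 := (fun j => (B j ord0)%:~R : C).

Lemma size_ell_symb j i : B j i != 0 -> size (ell_symb e1 e2 j) = 2.
Proof.
move=> Bji; have e1_neq0 : e1 j != 0.
  rewrite intr_eq0; apply: contraNneq Bji => /kappaP[B0 B1].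
  by apply/eqP; move: i; apply: ord2P.
by rewrite /ell_symb size_MXaddC polyC_eq0 (negPf e1_neq0) size_polyC e1_neq0.
Qed.

Lemma size_prod_ell (u : mindex n) i : (forall j, (0 < u j)%N -> B j i != 0) ->
  size (\prod_j ell_symb e1 e2 j ^+ u j) = (mdeg u).+1.
Proof. by move=> uB; apply: size_prod_linear => j /uB /size_ell_symb. Qed.

Lemma root_ell_symb j r : root (ell_symb e1 e2 j) r ->
  (B j ord0)%:~R * (kappa%:R * r + 1) + (B j ord_max)%:~R * r = 0 :> C.
Proof.
rewrite /root /ell_symb !hornerE => /eqP E; rewrite -[RHS]E rmorphD rmorphMn /= -mulr_natr.
by ring.
Qed.

(** The vector (kappa r + 1, r) is orthogonal to rows [j], [l] with first entries of opposite signs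
    and to a row [o] with positive second entry. If r were 0, row [j] would have first entry 0; if
    the first coordinate were 0, row [o] would have second entry 0. Thus rows [j] and [l] are
    proportional with nonzero second entries, also of opposite signs. *)
Lemma no_common_root r :
  ~ [/\ root (\prod_j ell_symb e1 e2 j ^+ colpos B ord0 j) r,
        root (\prod_j ell_symb e1 e2 j ^+ colneg B ord0 j) r,
        root (\prod_j ell_symb e1 e2 j ^+ colpos B ord_max j) r
      & root (\prod_j ell_symb e1 e2 j ^+ colneg B ord_max j) r].
Proof.
case=> /root_prod_exp[j /colpos_gt0 j0 /root_ell_symb jr].
case/root_prod_exp=> l /colneg_gt0 l0 /root_ell_symb lr.
case/root_prod_exp=> o /colpos_gt0 o1 /root_ell_symb or _.
set x := _ + 1 in jr lr or.
have r_neq0 : r != 0.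
  apply/negP => /eqP rE; move: jr; rewrite /x rE !mulr0 add0r mulr1 addr0 => /eqP.
  by rewrite intr_eq0 gt_eqF.
have x_neq0 : x != 0.
  apply/negP => /eqP xE; move: or; rewrite xE mulr0 add0r => /eqP.
  by rewrite mulf_eq0 (negPf r_neq0) orbF intr_eq0 gt_eqF.
have det0 : B j ord0 * B l ord_max - B j ord_max * B l ord0 = 0.
  apply/eqP; rewrite -(intr_eq0 C); apply/eqP/(mulIf r_neq0).
  rewrite mul0r rmorphB !rmorphM /= [LHS](_ : _ = (B j ord0)%:~R * ((B l ord0)%:~R * x + (B l ord_max)%:~R * r) -
    (B l ord0)%:~R * ((B j ord0)%:~R * x + (B j ord_max)%:~R * r)).
    by rewrite jr lr !mulr0 subrr.
  by ring.
have j1 : B j ord_max != 0.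
  apply/negP => /eqP jE; move: jr; rewrite jE mul0r addr0 => /eqP.
  by rewrite mulf_eq0 (negPf x_neq0) orbF intr_eq0 gt_eqF.
apply: (no_opposite (j := j) (k := l)); split=> //; first by rewrite pmulr_rlt0.
rewrite -(pmulr_rlt0 _ j0) mulrCA (_ : B j ord0 * _ = B j ord_max * B l ord0).
  by rewrite mulrA nmulr_llt0 // -expr2 exprn_even_gt0.
by apply/eqP; rewrite -subr_eq0 det0.
Qed.
End Quadrants.

Theorem theorem12p2 (R : realType) (n : nat) (B : 'M[int]_(n, 2))
    (A : 'M[int]_(n - 2, n)) :
  (2 < n)%N ->
  \rank (map_mx (intr : int -> rat) B) = 2%N ->
  (forall i : 'I_2, \sum_(j < n) B j i = 0) ->
  \rank (map_mx (intr : int -> rat) A) = (n - 2)%N ->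
  (forall (k : 'I_(n - 2)) (j : 'I_n), val k = 0%N -> A k j = 1) ->
  A *m B = 0 ->
  (* no two rows b_j, b_k that are linearly dependent and lie in the
     interiors of opposite quadrants of Z^2 *)
  (forall j k : 'I_n,
      ~ [/\ B j ord0 * B k ord_max - B j ord_max * B k ord0 = 0,
            B j ord0 * B k ord0 < 0
          & B j ord_max * B k ord_max < 0]) ->
  forall c : 'I_n -> R[i],
    hrank A B c (degB B ord0 * degB B ord_max)%N.
Proof.
move=> _ rankB Bsum rankA _ AB0 no_opposite c.
have [kappa kappaP] := transversal_direction B.
pose e1 j : R[i] := (B j ord0 *+ kappa + B j ord_max)%:~R.
pose e2 j : R[i] := (B j ord0)%:~R.
pose AC i j : R[i] := (A i j)%:~R.
have [M MB] := @exponent_left_inverse R[i] n B rankB.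
(* The dual vectors for the turned coordinates, in which [e1] is kappa times the first column plus
   the second and [e2] is the first column. *)
pose m1 := M ord_max; pose m2 j := M ord0 j - kappa%:R * M ord_max j.
have e1E j : e1 j = kappa%:R * (B j ord0)%:~R + (B j ord_max)%:~R.
  by rewrite /e1 rmorphD rmorphMn /= -mulr_natl.
have sum_e1 (w : 'I_n -> R[i]) : \sum_j w j * e1 j =
    kappa%:R * (\sum_j w j * (B j ord0)%:~R) + \sum_j w j * (B j ord_max)%:~R.
  rewrite mulr_sumr -big_split; apply: eq_bigr => j _ /=.
  by rewrite e1E; ring.
have m1e1 : \sum_j m1 j * e1 j = 1 by rewrite sum_e1 !MB mulr0 add0r.
have m1e2 : \sum_j m1 j * e2 j = 0 by rewrite MB.
have sum_m2 (h : 'I_n -> R[i]) : \sum_j m2 j * h j =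
    \sum_j M ord0 j * h j - kappa%:R * \sum_j M ord_max j * h j.
  by rewrite mulr_sumr -sumrB; apply: eq_bigr => j _; rewrite /m2; ring.
have m2e1 : \sum_j m2 j * e1 j = 0 by rewrite sum_m2 !sum_e1 !MB /=; ring.
have m2e2 : \sum_j m2 j * e2 j = 1 by rewrite sum_m2 !MB /= mulr0 subr0.
have A_ker (w : 'I_n -> R[i]) : \sum_j w j * e1 j = 0 -> \sum_j w j * e2 j = 0 ->
    exists y, forall j, w j = \sum_i y i * AC i j.
  rewrite sum_e1 => we1 we2; apply: (relation_kernel rankB rankA AB0) => //.
  by apply: ord2P; [exact: we2|move: we1; rewrite we2 mulr0 add0r].
have AB i l : \sum_j AC i j * (B j l)%:~R = 0.
  have /matrixP/(_ i l)/(congr1 (fun x : int => x%:~R : R[i])) := AB0.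
  rewrite !mxE rmorph_sum => AB; rewrite -[RHS]AB.
  by apply: eq_bigr => j _; rewrite rmorphM.
have Ae1 i : \sum_j AC i j * e1 j = 0 by rewrite sum_e1 !AB mulr0 addr0.
have Ae2 i : \sum_j AC i j * e2 j = 0 by rewrite AB.
(* The columns of [B] expressed through [e1] and [e2]: the first is [e2], the second is
   [e1 - kappa e2]. *)
pose g (i : 'I_2) : R[i] * R[i] := if i == ord0 then (0, 1) else (1, - kappa%:R).
have gP i : shift_vector e1 e2 (colpos B i) (colneg B i) (g i).
  by move=> j; rewrite col_diff; move: i; apply: ord2P; rewrite /g /= e1E /e2; ring.
have deg_neg i : mdeg (colneg B i) = mdeg (colpos B i) := mdeg_colneg (Bsum i).
(* A column of degree 0 has no positive entries and, its entries summing to zero, vanishes; the left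
   inverse excludes this. *)
have degB_gt0 i : (0 < degB B i)%N.
  rewrite -mdeg_colpos lt0n; apply/negP => deg0.
  have := MB i i; rewrite eqxx big1 => [/eqP|j _]; first by rewrite eq_sym oner_eq0.
  have deg0' : mdeg (colneg B i) == 0%N by rewrite deg_neg.
  move: deg0 deg0'; rewrite /mdeg !sum_nat_eq0 => /forallP/(_ j)/eqP p0 /forallP/(_ j)/eqP q0.
  by rewrite -col_diff p0 q0 subrr mulr0.
have [a aE] : exists a, degB B ord0 = a.+1 by exists (degB B ord0).-1; rewrite prednK.
have [b bE] : exists b, degB B ord_max = b.+1 by exists (degB B ord_max).-1; rewrite prednK.
have size_pos i : size (\prod_j ell_symb e1 e2 j ^+ colpos B i j) = (degB B i).+1.
  rewrite -mdeg_colpos; apply: (@size_prod_ell R[i] n B kappa kappaP _ i) => j /colpos_gt0.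
  by move/gt_eqF => ->.
have size_neg i : size (\prod_j ell_symb e1 e2 j ^+ colneg B i j) = (degB B i).+1.
  rewrite -mdeg_colpos -deg_neg; apply: (@size_prod_ell R[i] n B kappa kappaP _ i) => j /colneg_gt0.
  by move/lt_eqF => ->.
have [z [z_inj torus]] := @torus_points R[i] n B rankB.
have [G [G0 GP]] := generic_coprime z_inj (etrans (size_pos ord0) (congr1 S aE))
  (etrans (size_neg ord0) (congr1 S aE)) (etrans (size_pos ord_max) (congr1 S bE))
  (etrans (size_neg ord_max) (congr1 S bE)) (@no_common_root R[i] n B kappa no_opposite) torus.
exists G; split=> // p /GP[p0 s1 s2 cop].
(* Off the coordinate hyperplanes the symbol is a nonzero scalar multiple of the pencil member, so
   degrees and coprimality carry over. *)
have symbE i : horn_symb e1 e2 p (colpos B i) (colneg B i) =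
    (mpow p (colpos B i) * mpow p (colneg B i))^-1 *:
    pencil (\prod_j ell_symb e1 e2 j ^+ colpos B i j) (\prod_j ell_symb e1 e2 j ^+ colneg B i j)
      (colpos B i) (colneg B i) p.
  rewrite /horn_symb /pencil !mul_polyC scalerBr !scalerA.
  by congr (_ *: _ - _ *: _); field; rewrite !mpow_neq0.
have scale_neq0 i : (mpow p (colpos B i) * mpow p (colneg B i))^-1 != 0.
  by rewrite invr_eq0 mulf_neq0 ?mpow_neq0.
have size_h1 : size (horn_symb e1 e2 p (colpos B ord0) (colneg B ord0)) = a.+2.
  by rewrite symbE size_scale.
have size_h2 : size (horn_symb e1 e2 p (colpos B ord_max) (colneg B ord_max)) = b.+2.
  by rewrite symbE size_scale.
have h_coprime : coprimep (horn_symb e1 e2 p (colpos B ord0) (colneg B ord0))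
    (horn_symb e1 e2 p (colpos B ord_max) (colneg B ord_max)).
  by rewrite !symbE coprimepZl // coprimepZr.
have u1_deg : mdeg (colpos B ord0) = a.+1 by rewrite mdeg_colpos.
have v1_deg : mdeg (colneg B ord0) = a.+1 by rewrite deg_neg.
have u2_deg : mdeg (colpos B ord_max) = b.+1 by rewrite mdeg_colpos.
have v2_deg : mdeg (colneg B ord_max) = b.+1 by rewrite deg_neg.
have [S [SP S_free S_span]] := hyper_system_basis m1e1 m1e2 m2e1 m2e2 A_ker Ae1 Ae2 p0 gP
  u1_deg v1_deg u2_deg v2_deg h_coprime size_h1 size_h2 1 c.
have graded := hyper_system_graded m1e1 m1e2 m2e1 m2e2 A_ker p0 gP
  u1_deg v1_deg u2_deg v2_deg h_coprime size_h1 size_h2.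
have mfact_neq0 (x : mindex n) : (mfact x)%:R != 0 :> R[i] by rewrite pnatr_eq0 -lt0n mfact_gt0.
(* The system governs Taylor coefficients, so its basis is divided by a! to give power series; their
   convergence rests on [graded]. *)
pose s l : pseries R n := fun x => S l x / (mfact x)%:R.
have taylor_s l x : taylor (s l) x = S l x by rewrite /taylor /s mulrC divfK.
have sumE (lam : 'I_(a.+1 * b.+1) -> R[i]) x :
    sum_ps [seq scale_ps (lam l) (s l) | l <- enum 'I_(a.+1 * b.+1)] x =
    (\sum_l lam l * S l x) / (mfact x)%:R.
  rewrite /sum_ps big_map big_enum mulr_suml; apply: eq_bigr => l _.
  by rewrite /scale_ps /s mulrA.
rewrite aE bE; exists s; split.
- move=> l; apply/solution_hyper_system.
  have sys_s : hyper_system AC p (colpos B) (colneg B) 1 c (taylor (s l)).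
    have [S1 S2] := SP l; split=> i x; rewrite !taylor_s; first exact: S1.
    rewrite -S2; apply: eq_bigr => j _; by rewrite !taylor_s.
  split=> //; have [Q [L [Q0 L0 QL]]] := hyper_system_growth (fun i => esym (deg_neg i)) graded sys_s.
  exact: growth_convergent Q0 L0 QL.
- move=> lam lam0; apply: S_free => x; have := lam0 x; rewrite sumE => /eqP.
  by rewrite mulf_eq0 invr_eq0 (negPf (mfact_neq0 x)) orbF => /eqP.
- move=> f /solution_hyper_system[_ /S_span[lam lamE]]; exists lam => x.
  by rewrite sumE -lamE /taylor mulrC mulKf.
Qed.
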